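(* Let $(H,\sigma)$ be a signed cycle-tree with an even number of negative cycles. Then $(H,\sigma)$ has a family of circuits $\mathcal F$ covering all cycles of $H$ (i.e. every edge lying on a cycle of $H$ belongs to some member of $\mathcal F$) with length $\ell(\mathcal F)=\sum_{C\in\mathcal F}|E(C)|\le \frac43|E(H)|$.
   Context: A signed graph $(H,\sigma)$ is a graph $H$ with $\sigma:E(H)\to\{-1,+1\}$; edges with $\sigma=-1$ are negative. A cycle is a connected 2-regular subgraph; it is positive if it has an even number of negative edges, negative otherwise. A barbell is a pair of edge-disjoint negative cycles joined by a path (possibly of length zero); a circuit is a positive cycle or a barbell. A cycle-tree is a connected graph with no vertex of degree 1 in which all cycles are pairwise edge-disjoint. A signed cycle-tree is a signed graph $(H,\sigma)$ such that $H$ is a cycle-tree and every cycle of $H$ contains at least one negative edge. *)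

(* Defs.v *)
From mathcomp Require Import all_boot all_order all_algebra.

Set Implicit Arguments.
Unset Strict Implicit.
Unset Printing Implicit Defensive.

(* Finite graphs with loops and parallel edges allowed.  The order of the two
   ends carries no meaning: the notions below are symmetric in them. *)
Record multigraph := Multigraph {
  vertex : finType;
  edge : finType;
  ends : edge -> vertex * vertex
}.

Section Graph.
Variable H : multigraph.

Definition joins (e : edge H) (x y : vertex H) : bool :=
  (ends e == (x, y)) || (ends e == (y, x)).

(* Only the pairs satisfying [is_subgraph] are subgraphs of H; using bare pairs
   keeps the type a finType. *)
Definition subgraph : Type := ({set vertex H} * {set edge H})%type.
Definition vset (S : subgraph) : {set vertex H} := S.1.
Definition eset (S : subgraph) : {set edge H} := S.2.

Definition is_subgraph (S : subgraph) : bool :=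
  [forall e in eset S, ((ends e).1 \in vset S) && ((ends e).2 \in vset S)].

Definition whole : subgraph := ([set: vertex H], [set: edge H]).

Definition adjacent (S : subgraph) : rel (vertex H) :=
  fun x y => [exists e in eset S, joins e x y].

Definition connected (S : subgraph) : bool :=
  (vset S != set0) &&
  [forall x in vset S, forall y in vset S, connect (adjacent S) x y].

(* A loop contributes 2. *)
Definition degree (S : subgraph) (x : vertex H) : nat :=
  \sum_(e in eset S) (((ends e).1 == x) + ((ends e).2 == x)).

Definition is_cycle (C : subgraph) : bool :=
  [&& is_subgraph C, connected C & [forall x in vset C, degree C x == 2]].

(* A walk from x is the list of its successive steps (edge, next vertex). *)
Fixpoint walk (x : vertex H) (p : seq (edge H * vertex H)) : bool :=
  if p is (e, y) :: p' then joins e x y && walk y p' else true.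

Definition walk_vertices (x : vertex H) (p : seq (edge H * vertex H)) :
  seq (vertex H) := x :: unzip2 p.
Definition walk_end (x : vertex H) (p : seq (edge H * vertex H)) : vertex H :=
  last x (unzip2 p).
Definition is_path (x : vertex H) (p : seq (edge H * vertex H)) : bool :=
  walk x p && uniq (walk_vertices x p).

Definition path_graph (x : vertex H) (p : seq (edge H * vertex H)) : subgraph :=
  ([set z in walk_vertices x p], [set e in unzip1 p]).

Definition union (S T : subgraph) : subgraph :=
  (vset S :|: vset T, eset S :|: eset T).

Definition cycle_tree : Prop :=
  [/\ connected whole,
      forall x : vertex H, degree whole x <> 1
    & forall C D : subgraph, is_cycle C -> is_cycle D -> C <> D ->
        [disjoint eset C & eset D]].

(* A signature is a boolean function s on the edges, the sign of e being
   (-1) ^ s e: the negative edges are those with s e = true. *)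
Variable s : edge H -> bool.

Definition negative_edges (S : subgraph) : {set edge H} :=
  [set e in eset S | s e].

Definition positive_cycle (C : subgraph) : bool :=
  is_cycle C && ~~ odd #|negative_edges C|.
Definition negative_cycle (C : subgraph) : bool :=
  is_cycle C && odd #|negative_edges C|.

(* The joining path meets each of the two cycles in the corresponding end only;
   for p = [::] this says that it is a common vertex of the two cycles. *)
Definition barbell (B : subgraph) : Prop :=
  exists (C D : subgraph) (x : vertex H) (p : seq (edge H * vertex H)),
    [/\ negative_cycle C, negative_cycle D & [disjoint eset C & eset D]] /\
    [/\ is_path x p,
        vset (path_graph x p) :&: vset C = [set x],
        vset (path_graph x p) :&: vset D = [set walk_end x p]
      & B = union (union C D) (path_graph x p)].

Definition circuit (S : subgraph) : Prop := positive_cycle S \/ barbell S.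

Definition signed_cycle_tree : Prop :=
  cycle_tree /\
  forall C : subgraph, is_cycle C -> exists2 e, e \in eset C & s e.

Definition covers_cycles (F : seq subgraph) : Prop :=
  forall (C : subgraph) (e : edge H), is_cycle C -> e \in eset C ->
    exists2 D, D \in F & e \in eset D.

Definition family_length (F : seq subgraph) : nat := \sum_(C <- F) #|eset C|.

End Graph.

(* Main.v *)
(* Contract the cycles of H to vertices, so that H becomes a tree, and give every
   subtree the parity of its number of negative cycles; only bridges to odd
   subtrees matter.  Call a strand a negative cycle with a path leading out of it.
   There are two ways to cover the cycles.
   - Every odd subtree sends out one strand.  Strands are joined into barbells
     where they meet, each cycle is used as a circuit or as the end of a barbell,
     and strands cross a cycle along every second arc between consecutive odd
     subtrees, so that they use at most half of its edges.
   - Every odd subtree sends out two strands, and the strands cross a cycle with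
     at least two odd subtrees along all of its arcs, covering it exactly once.
     A negative cycle with only one odd neighbour is the end of two barbells.
   Let k1 and k2 be the lengths of the two families.  A bridge adds at most 1 and 2
   times its length to k1 and k2, a cycle at most 3/2 and 1 times, or else 1 and 2
   times, so 2 k1 + k2 <= 4 |E(H)|, and one of the families is short enough. *)
Require Import Defs.
From mathcomp Require Import all_boot all_order all_algebra.
From mathcomp Require Import zify.
Import Order.TTheory GRing.Theory Num.Theory.

Set Implicit Arguments.
Unset Strict Implicit.
Unset Printing Implicit Defensive.

(** * Walks, simple paths and cycles in a multigraph *)

Section Walks.
Variable H : multigraph.
Implicit Types (x y z u v w : vertex H) (e f : edge H).
Implicit Types (p q : seq (edge H * vertex H)).
Implicit Types (P X Y : {set vertex H}) (S E Z : {set edge H}).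
Implicit Types (C D : subgraph H).

Lemma joinsC e x y : joins e x y = joins e y x.
Proof. by rewrite /joins orbC. Qed.

Lemma joins_ends e : joins e (ends e).1 (ends e).2.
Proof. by rewrite /joins -surjective_pairing eqxx. Qed.

Lemma joins_incidence e x y z : joins e x y ->
  ((ends e).1 == z) + ((ends e).2 == z) = (z == x) + (z == y).
Proof.
by case/orP=> /eqP ->; rewrite /= [z == x]eq_sym [z == y]eq_sym // addnC.
Qed.

Lemma joins_in e x y X : joins e x y ->
  ((ends e).1 \in X) && ((ends e).2 \in X) = (x \in X) && (y \in X).
Proof. by case/orP=> /eqP -> //=; rewrite andbC. Qed.

Lemma walk_ends x p f : walk x p -> f \in unzip1 p ->
  ((ends f).1 \in walk_vertices x p) && ((ends f).2 \in walk_vertices x p).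
Proof.
elim: p x => //= -[e y] p IH x /= /andP[exy wp]; rewrite inE.
have sub : {subset walk_vertices y p <= walk_vertices x ((e, y) :: p)}.
  by move=> z; rewrite /walk_vertices /= !inE => ->; rewrite orbT.
case/orP=> [/eqP-> | /(IH _ wp)/andP[h1 h2]]; last by rewrite !sub.
by case/orP: exy => /eqP ->; rewrite /walk_vertices /= !inE !eqxx ?orbT.
Qed.

(** A simple path reduced to its vertex set and its edge set: reversing it changes nothing but the
    order of its ends, and concatenation is a union. *)
Definition link x y P S : Prop := exists p,
  [/\ is_path x p, walk_end x p = y, P = [set z in walk_vertices x p]
    & S = [set f in unzip1 p]].

Lemma link_refl x : link x x [set x] set0.
Proof.
by exists [::]; split=> //; apply/setP => z; rewrite !inE.
Qed.

Lemma link_step e x y : joins e x y -> x != y -> link x y [set x; y] [set e].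
Proof.
move=> exy nxy; exists [:: (e, y)]; split=> //.
- by rewrite /is_path /= exy !inE nxy.
- by apply/setP => z; rewrite !inE.
by apply/setP => z; rewrite !inE.
Qed.

Lemma link_ends x y P S : link x y P S -> (x \in P) && (y \in P).
Proof.
case=> p [_ <- -> _]; rewrite !inE eqxx /=.
by have := mem_last x (unzip2 p); rewrite inE.
Qed.

Lemma walk_cat x p q : walk x (p ++ q) = walk x p && walk (walk_end x p) q.
Proof. by elim: p x => //= -[e b] p IH x /=; rewrite IH andbA. Qed.

Lemma link_cat x y z P S P' S' : link x y P S -> link y z P' S' ->
  P :&: P' \subset [set y] -> link x z (P :|: P') (S :|: S').
Proof.
move=> xy yz; have /andP[_ yP] := link_ends xy.
have /andP[yP' _] := link_ends yz.
case: xy yP => p [/andP[wp up] ey -> ->]; subst y.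
case: yz yP' => q [/andP[wq uq] <- -> ->].
move=> yP' yP dis; exists (p ++ q); split.
- rewrite /is_path walk_cat wp wq !andTb /walk_vertices /unzip2 map_cat -(cat_cons x).
  rewrite cat_uniq; move: up; rewrite /walk_vertices => -> /=; move: uq; rewrite /walk_vertices cons_uniq => /andP[nq ->].
  rewrite andbT; apply/hasPn=> b bq; apply/negP=> bp.
  have : b \in [set walk_end x p].
    apply: (subsetP dis); rewrite in_setI !in_set; apply/andP; split; first exact: bp.
    by rewrite /walk_vertices in_cons; apply/orP; right; exact: bq.
  by rewrite inE => /eqP eb; rewrite -eb bq in nq.
- by rewrite /walk_end /unzip2 map_cat last_cat.
- apply/setP => b; rewrite in_setU !in_set /walk_vertices /unzip2 map_cat -cat_cons.
  rewrite mem_cat (in_cons (walk_end x p)).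
  have [->|_] //= := eqVneq b (walk_end x p).
  by move: yP; rewrite in_set => ->.
by apply/setP=> b; rewrite !inE /unzip1 map_cat mem_cat.
Qed.

Lemma link_sym x y P S : link x y P S -> link y x P S.
Proof.
case=> p [ip ey -> ->]; elim: p x ip ey => [|[e a] p IH] x.
  move=> _ <-; exists [::]; split=> //.
rewrite /is_path /= => /andP[/andP[exa wp] /andP[nx up]] ey.
have ipa : is_path a p by rewrite /is_path wp.
have nax : a != x by apply: contraNneq nx => ->; rewrite mem_head.
have sax : link a x [set a; x] [set e] by apply: link_step => //; rewrite joinsC.
have lnk := IH a ipa ey.
have -> : [set z in walk_vertices x ((e, a) :: p)]
   = [set z in walk_vertices a p] :|: [set a; x].
  apply/setP=> z; rewrite /walk_vertices !inE /=.
  by case: (z == x); case: (z == a) => //=; rewrite ?orbT ?orbF.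
have -> : [set f in e :: unzip1 p] = [set f in unzip1 p] :|: [set e].
  by apply/setP=> z; rewrite !inE /= orbC.
apply: link_cat lnk sax _; apply/subsetP=> z; rewrite in_setI in_set2 in_set1.
case/andP=> zp /orP[] // /eqP zx; move: nx zp.
by rewrite zx inE /walk_vertices => /negPf->.
Qed.

(** Counting each end once more on the left gives one equation for inner vertices, ends, the trivial
    path and vertices off the path. *)
Lemma path_degree x p z : is_path x p ->
  degree (path_graph x p) z + (z == x) + (z == walk_end x p)
  = (z \in walk_vertices x p).*2.
Proof.
elim: p x => [|[e y] p IH] x.
  move=> _; rewrite /degree big_pred0 /walk_vertices /walk_end /=; last first.
    by move=> f; rewrite !inE.
  by rewrite inE addnn.
rewrite /is_path /= => /andP[/andP[exy wp] /andP[nx up]].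
have ip : is_path y p by rewrite /is_path wp.
have ne : e \notin unzip1 p.
  apply: contra nx => /(walk_ends wp); case/orP: exy => /eqP -> /andP[] //.
have -> : degree (path_graph x ((e, y) :: p)) z =
    (z == x) + (z == y) + degree (path_graph y p) z.
  rewrite /degree /= (bigD1 e) /=; last by rewrite !inE eqxx.
  rewrite (joins_incidence _ exy); congr (_ + _); apply: eq_bigl => f.
  rewrite !inE /=; have [->|_] := eqVneq f e; last by rewrite andbT.
  by rewrite (negPf ne) andbF.
have := IH y ip; have -> : walk_end x ((e, y) :: p) = walk_end y p by [].
have -> : (z \in walk_vertices x ((e, y) :: p)) = (z == x) || (z \in walk_vertices y p).
  by rewrite /walk_vertices inE.
have : z == x -> z \notin walk_vertices y p by move=> /eqP->.
by case: (z == x) => [/(_ isT)/negPf ->|_] /=; lia.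
Qed.

Lemma adjacent_sym (T : subgraph H) : connect_sym (adjacent T).
Proof.
apply: sym_connect_sym => a b; rewrite /adjacent.
by apply: eq_existsb => f; rewrite joinsC.
Qed.

Lemma walk_connect (T : subgraph H) x p a : walk x p ->
  {subset unzip1 p <= eset T} -> a \in walk_vertices x p ->
  connect (adjacent T) x a.
Proof.
elim: p x a => [|[f b] p IH] x a.
  by rewrite /walk_vertices inE => _ _ /eqP ->.
case/andP=> fxb wp sub; rewrite inE => /orP[/eqP -> //|ap].
apply: (@connect_trans _ _ b).
  by apply: connect1; apply/existsP; exists f; rewrite fxb sub ?mem_head.
by apply: IH => // g gp; apply: sub; rewrite inE gp orbT.
Qed.

Lemma cycle_of_path x p e : is_path x p -> joins e (walk_end x p) x ->
  e \notin unzip1 p ->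
  is_cycle ([set z in walk_vertices x p], e |: [set f in unzip1 p]).
Proof.
move=> ip ex ne; have [wp _] := andP ip.
have endp : walk_end x p \in walk_vertices x p by apply: mem_last.
apply/and3P; split.
- apply/forall_inP => f; rewrite in_setU1 !in_set => /orP[/eqP-> | fp].
    by case/orP: ex => /eqP -> /=; rewrite endp mem_head.
  exact: walk_ends.
- set T := (X in connected X).
  have con a : a \in walk_vertices x p -> connect (adjacent T) x a.
    by apply: walk_connect => // f fp; rewrite !inE fp orbT.
  apply/andP; split; first by apply/set0Pn; exists x; rewrite inE mem_head.
  apply/forall_inP=> a; rewrite inE => /con xa; apply/forall_inP=> b.
  by rewrite inE => /con; apply: connect_trans; rewrite adjacent_sym.
apply/forall_inP=> z; rewrite /= inE => zp; apply/eqP.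
rewrite /degree /= (bigD1 e) /=; last by rewrite !inE eqxx.
rewrite (joins_incidence _ ex) (eq_bigl [in eset (path_graph x p)]); last first.
  move=> f; rewrite !inE; have [->|_] := eqVneq f e; last by rewrite andbT.
  by rewrite (negPf ne).
by have := path_degree z ip; rewrite zp /degree; lia.
Qed.

Lemma connect_path (T : subgraph H) x y : connect (adjacent T) x y ->
  exists p, [/\ is_path x p, walk_end x p = y & {subset unzip1 p <= eset T}].
Proof.
case/connectP=> q0 pq0 ->; case: (shortenP pq0) => q pq uq _ {q0 pq0}.
have [p [wp eq sub]] : exists p,
    [/\ walk x p, unzip2 p = q & {subset unzip1 p <= eset T}].
  elim: q x pq {uq} => [|b q IH] x /=; first by exists [::].
  case/andP=> /existsP[f /andP[fT fxb]] /IH[p [wp e2 sub]].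
  exists ((f, b) :: p); rewrite /= fxb wp e2; split=> // g.
  by rewrite inE => /orP[/eqP->|/sub].
by exists p; rewrite /is_path wp /walk_vertices /walk_end eq.
Qed.

(** An edge of a cycle is no bridge of it. Otherwise [e] would be the only edge of [C] with exactly
    one end in the component [Q] of [w] in [C] minus [e], and the degree sum over [Q] would be odd,
    although all degrees are 2. *)
Lemma cycle_avoid C e u w : is_cycle C -> e \in eset C -> joins e u w ->
  connect (adjacent (vset C, eset C :\ e)) w u.
Proof.
case/and3P=> /forall_inP sC _ /forall_inP dC eC euw.
set T := (_, _); set Q := [set z in vset C | connect (adjacent T) w z].
have QT f x y : f \in eset C -> f != e -> joins f x y -> (x \in Q) = (y \in Q).
  move=> fC fe fxy; have sc x' y' : joins f x' y' -> x' \in Q -> y' \in Q.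
    move=> j; rewrite !inE => /andP[_ wx].
    have := sC f fC; rewrite (joins_in _ j) => /andP[_ ->] /=.
    apply: connect_trans wx _; apply: connect1.
    by apply/existsP; exists f; rewrite !inE fe fC.
  by apply/idP/idP; apply: sc; rewrite // joinsC.
have /andP[uC wC] : (u \in vset C) && (w \in vset C).
  by have := sC e eC; rewrite (joins_in _ euw).
have wQ : w \in Q by rewrite !inE wC connect0.
have [uQ|nuQ] := boolP (u \in Q); first by move: uQ; rewrite inE => /andP[].
(* Double counting: an edge contributes to the degree sum over [Q] once for each of its ends in
   [Q]. *)
have inc f : \sum_(z in Q) (((ends f).1 == z) + ((ends f).2 == z))
    = ((ends f).1 \in Q) + ((ends f).2 \in Q).
  have one a : \sum_(z in Q) (a == z) = (a \in Q).
    have [aQ|naQ] := boolP (a \in Q).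
      rewrite (bigD1 a) //= eqxx big1 // => z /andP[_ za].
      by rewrite eq_sym (negPf za).
    by rewrite big1 // => z zQ; case: eqP => // az; rewrite az zQ in naQ.
  by rewrite big_split /= !one.
have : odd (\sum_(z in Q) degree C z).
  rewrite /degree exchange_big /= (eq_bigr _ (fun f _ => inc f)) (bigD1 e) //= oddD.
  have -> : odd (((ends e).1 \in Q) + ((ends e).2 \in Q)).
    by case/orP: euw => /eqP -> /=; rewrite wQ (negPf nuQ).
  rewrite big_mkcond /= -[odd _]negbK; suff -> : ~~ odd (\sum_f (if (f \in eset C) && (f != e)
      then ((ends f).1 \in Q) + ((ends f).2 \in Q) else 0)) by [].
  apply: (big_ind (fun n => ~~ odd n)) => // [a b|f _].
    by rewrite oddD => /negPf-> /negPf->.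
  case: ifP => // /andP[fC fe].
  by rewrite (QT f _ _ fC fe (joins_ends f)) addnn odd_double.
rewrite (eq_bigr (fun _ => 2)); last first.
  by move=> z; rewrite inE => /andP[zC _]; apply/eqP/dC.
by rewrite sum_nat_const muln2 odd_double.
Qed.

(** * Graphs with edge-disjoint cycles, grown from a single vertex *)

Definition edge_disjoint_cycles := forall C D : subgraph H,
  is_cycle C -> is_cycle D -> C <> D -> [disjoint eset C & eset D].

Hypothesis edc : edge_disjoint_cycles.

Lemma cycle_unique C D e : is_cycle C -> is_cycle D ->
  e \in eset C -> e \in eset D -> C = D.
Proof.
move=> cC cD eC eD; apply/eqP/negP=> /negP/eqP nCD.
by have /pred0P/(_ e) := edc cC cD nCD; rewrite /= eC eD.
Qed.

(** A path that avoids [e] closes up with [e] to a cycle sharing [e] with [C]; edge-disjointness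
    makes it all of [C]. *)
Lemma cycle_traversal C e u w : is_cycle C -> e \in eset C -> joins e u w ->
  exists p, [/\ is_path w p, walk_end w p = u, e \notin unzip1 p
    & C = ([set z in walk_vertices w p], e |: [set f in unzip1 p])].
Proof.
move=> cC eC euw; have /connect_path[p [ip eu sub]] := cycle_avoid cC eC euw.
have ne : e \notin unzip1 p by apply/negP=> /sub; rewrite !inE eqxx.
exists p; split=> //; apply: (@cycle_unique _ _ e) => //; last by rewrite !inE eqxx.
by apply: cycle_of_path => //; rewrite eu.
Qed.

Lemma cycle_edge_at C v : is_cycle C -> v \in vset C ->
  exists e u, e \in eset C /\ joins e u v.
Proof.
case/and3P=> _ _ /forall_inP dC /dC.
case: (pickP [pred e in eset C | ((ends e).1 == v) || ((ends e).2 == v)]) => [e|no].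
  case/andP=> eC /orP[] /eqP ev _; exists e.
    by exists (ends e).2; rewrite eC -ev joinsC joins_ends.
  by exists (ends e).1; rewrite eC -ev joins_ends.
rewrite /degree big1 // => e eC; have /negbT := no e.
by rewrite /= eC /= negb_or => /andP[/negPf-> /negPf->].
Qed.

(** This construction stands in for the tree of contracted cycles: each step attaches a bridge with
    a new end, or a whole cycle meeting the old part in one vertex. Undone from the last step, it
    contracts the graph piece by piece. *)
Inductive grow x0 : {set vertex H} -> {set edge H} -> Prop :=
| grow_root : grow x0 [set x0] set0
| grow_bridge X E v w e : grow x0 X E -> v \in X -> w \notin X -> joins e v w ->
    e \notin E -> (forall C, is_cycle C -> e \notin eset C) ->
    grow x0 (w |: X) (e |: E)
| grow_cycle X E v C : grow x0 X E -> is_cycle C -> vset C :&: X = [set v] ->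
    [disjoint eset C & E] -> grow x0 (X :|: vset C) (E :|: eset C).

(** No cycle is cut by [Z]; this makes the number of negative cycles additive over disjoint
    parts. *)
Definition saturated Z := forall C, is_cycle C ->
  eset C \subset Z \/ [disjoint eset C & Z].

Lemma saturatedU Z1 Z2 : saturated Z1 -> saturated Z2 -> saturated (Z1 :|: Z2).
Proof.
move=> s1 s2 C cC; case: (s1 C cC) => [sub|d1]; first by left; rewrite subsetU ?sub.
case: (s2 C cC) => [sub|d2]; first by left; rewrite subsetU ?sub ?orbT.
right; move: d1 d2; rewrite -!setI_eq0 setIUr => /eqP -> /eqP ->.
by rewrite setU0.
Qed.

Lemma saturated_cycle C : is_cycle C -> saturated (eset C).
Proof.
move=> cC D cD; have [->|/eqP nDC] := eqVneq D C; [by left | by right; apply: edc].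
Qed.

Lemma saturated_bridge e : (forall C, is_cycle C -> e \notin eset C) ->
  saturated [set e].
Proof. by move=> ne C /ne eC; right; rewrite disjoint_sym disjoints1. Qed.

Lemma saturated0 : saturated set0.
Proof. by move=> C _; right; rewrite -setI_eq0 setI0. Qed.

Lemma cycle_connect C x y : is_cycle C -> x \in vset C -> y \in vset C ->
  connect (adjacent C) x y.
Proof.
by case/and3P=> _ /andP[_ /forall_inP h] _ /h/forall_inP/[apply].
Qed.

Lemma connect_sub (T T' : subgraph H) x y : eset T \subset eset T' ->
  connect (adjacent T) x y -> connect (adjacent T') x y.
Proof.
move=> sub; apply: connect_sub => a b /existsP[e /andP[eT j]].
by apply: connect1; apply/existsP; exists e; rewrite j (subsetP sub).
Qed.

Lemma grow_saturated x0 X E : grow x0 X E -> saturated E.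
Proof.
elim=> [|*|*]; first exact: saturated0.
  by apply: saturatedU => //; apply: saturated_bridge.
by apply: saturatedU => //; apply: saturated_cycle.
Qed.

Lemma grow_subgraph x0 X E : grow x0 X E -> is_subgraph (X, E).
Proof.
elim=> [|{}X {}E v w e _ sub vX wX evw _ _|{}X {}E v C _ sub cC _ _];
  apply/forall_inP=> f; rewrite !inE //= => fE.
  case/orP: fE => [/eqP->|fE].
    by case/orP: evw => /eqP-> /=; rewrite eqxx vX ?orbT.
  by have /andP[-> ->] := forall_inP sub f fE; rewrite !orbT.
case/orP: fE => fE; first by have /andP[-> ->] := forall_inP sub f fE.
by have /andP[/forall_inP/(_ f fE)/andP[-> ->] _] := cC; rewrite !orbT.
Qed.

Lemma grow_connect x0 X E x : grow x0 X E -> x \in X ->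
  connect (adjacent (X, E)) x0 x.
Proof.
move=> g; elim: g x => [|{}X {}E v w e _ IH vX wX evw _ _|{}X {}E v C _ IH cC CX _] x.
- by rewrite inE => /eqP->.
- have up y : connect (adjacent (X, E)) x0 y ->
      connect (adjacent (w |: X, e |: E)) x0 y.
    by apply: connect_sub; apply: subsetUr.
  rewrite !inE => /orP[/eqP->|/IH/up //]; apply: connect_trans (up v (IH v vX)) _.
  by apply: connect1; apply/existsP; exists e; rewrite !inE eqxx.
have up y : connect (adjacent (X, E)) x0 y ->
    connect (adjacent (X :|: vset C, E :|: eset C)) x0 y.
  by apply: connect_sub; apply: subsetUl.
rewrite !inE => /orP[/IH/up //|xC].
have : v \in vset C :&: X by rewrite CX inE.
rewrite inE => /andP[vC vX]; apply: connect_trans (up v (IH v vX)) _.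
apply: connect_sub (cycle_connect cC vC xC); exact: subsetUr.
Qed.

Lemma grow_path x0 X E x y : grow x0 X E -> x \in X -> y \in X ->
  exists p, [/\ is_path x p, walk_end x p = y & {subset unzip1 p <= E}].
Proof.
move=> g xX yX; apply: (@connect_path (X, E)).
apply: connect_trans (grow_connect g yX); rewrite adjacent_sym.
exact: grow_connect g xX.
Qed.

(* If C met X in a second vertex u', the arc of C from u to u' followed by a path
   back through E would contain a cycle sharing edges with C but missing others. *)
Lemma grow_cycle_meet x0 X E C e u w : grow x0 X E -> is_cycle C ->
  e \in eset C -> e \notin E -> joins e u w -> u \in X ->
  vset C :&: X = [set u].
Proof.
move=> g cC eC neE euw uX.
have dCE : [disjoint eset C & E].
  by case: (grow_saturated g cC) => // /subsetP/(_ e eC); rewrite (negPf neE).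
have uC : u \in vset C.
  have /and3P[/forall_inP/(_ e eC) + _ _] := cC.
  by rewrite (joins_in _ euw) => /andP[].
apply/setP=> u'; rewrite !inE; apply/andP/eqP=> [[u'C u'X]|->]; last by [].
apply/eqP/negP=> /negP nu; rewrite joinsC in euw.
have [p [/andP[wp up] pw nep defC]] := cycle_traversal cC eC euw.
move: u'C; rewrite defC /= inE /walk_vertices inE (negPf nu) /= => u'p.
have [q [iq qu qE]] := grow_path g u'X uX.
case: p wp up pw nep defC u'p => // -[f c] p /= /andP[fuc wp] /andP[nup up] pw nep defC u'p.
have fC : f \in eset C by rewrite defC !inE eqxx orbT.
have nfp : f \notin unzip1 p.
  by apply: contra nup => /(walk_ends wp); case/orP: fuc => /eqP -> /andP[].
have [r [ir ru rsub]] : exists r, [/\ is_path c r, walk_end c r = u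
    & {subset unzip1 r <= [set h in unzip1 p] :|: E}].
  apply: (@connect_path (X, [set h in unzip1 p] :|: E)).
  apply: (@connect_trans _ _ u').
    by apply: walk_connect wp _ u'p => h hp; rewrite !inE hp.
  rewrite -qu; have [wq _] := andP iq; apply: walk_connect wq _ _.
    by move=> h /qE hE; rewrite !inE hE orbT.
  exact: mem_last.
have nfr : f \notin unzip1 r.
  apply/negP=> /rsub; rewrite !inE (negPf nfp) /= => fE.
  by have /pred0P/(_ f) := dCE; rewrite /= fC fE.
have cD := cycle_of_path ir _ nfr; rewrite ru in cD.
have eqCD := cycle_unique cC (cD fuc) fC (setU11 _ _).
move: eC; rewrite eqCD /= in_setU1 inE.
move: nep; rewrite inE negb_or => /andP[/negPf-> np] /= /rsub.
by rewrite !inE (negPf np) (negPf neE).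
Qed.

(** If [w] were already reached, a path through [E] from [w] to [u] would close with [e] to a cycle
    through [e]. *)
Lemma grow_bridge_new x0 X E e u w : grow x0 X E ->
  (forall C, is_cycle C -> e \notin eset C) ->
  e \notin E -> joins e u w -> u \in X -> w \notin X.
Proof.
move=> g ne neE euw uX; apply/negP=> wX.
have [p [ip pu pE]] := grow_path g wX uX; have nep : e \notin unzip1 p.
  by apply: contra neE => /pE.
have cC := cycle_of_path ip _ nep; rewrite pu in cC.
by have := ne _ (cC euw); rewrite !inE eqxx.
Qed.

Lemma grow_frontier x0 X E : grow x0 X E ->
    (forall x, connect (adjacent (whole H)) x0 x) ->
  X = setT /\ E = setT \/ exists e u w, [/\ e \notin E, joins e u w & u \in X].
Proof.
move=> g con.
case: (pickP [pred e | (e \notin E) && (((ends e).1 \in X) || ((ends e).2 \in X))]).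
  move=> e /andP[neE /orP[] eX]; right.
    by exists e, (ends e).1, (ends e).2; split=> //; apply: joins_ends.
  by exists e, (ends e).2, (ends e).1; split=> //; rewrite joinsC joins_ends.
move=> noe; left; have XT : X = setT.
  apply/setP=> x; rewrite inE; have /connect_path[p [/andP[wp _] <- _]] := con x.
  have x0X : x0 \in X by elim: g => [|*|*]; rewrite ?inE ?eqxx //; apply/orP; [right|left].
  have closed e a y : joins e a y -> a \in X -> y \in X.
    move=> eay aX; have /negbT := noe e; rewrite /= negb_and negbK orbC.
    case/orP=> [|eE]; first by case/orP: eay => /eqP -> /=; rewrite aX ?orbT.
    by have := forall_inP (grow_subgraph g) e eE; rewrite (joins_in _ eay) => /andP[].
  elim: p x0 x0X wp {g con} => //= -[e y] p IH a aX /andP[eay wp].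
  exact: IH (closed e a y eay aX) wp.
split=> //; apply/setP=> e; rewrite inE; have /negbT := noe e.
by rewrite /= XT !inE andbT negbK.
Qed.

(** Induction on the number of edges outside [E]: at the frontier, an edge on a cycle brings in the
    whole cycle, and any other edge is a bridge to a new vertex. *)
Lemma grow_full : connected (whole H) -> exists x0, grow x0 setT setT.
Proof.
case/andP=> /set0Pn[x0 _] /forall_inP/(_ x0 (in_setT _))/forall_inP con.
exists x0; suff ind n X E : #|~: E| <= n -> grow x0 X E -> grow x0 setT setT.
  exact: ind (leqnn _) (grow_root x0).
elim: n X E => [|n IH] X E leE g.
  all: case: (grow_frontier g (fun x => con x (in_setT _))) => [[<- <-] //|[e [u [w [neE euw uX]]]]].
  by move: leE; rewrite leqn0 cards_eq0 => /eqP/setP/(_ e); rewrite !inE neE.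
have card E' : e \in E' -> #|~: (E :|: E')| <= n.
  move=> eE'; rewrite -ltnS; apply: leq_trans leE; apply: proper_card.
  apply/properP; split; first by rewrite setCS subsetUl.
  by exists e; rewrite !inE ?neE // eE' orbT.
case: (pickP [pred C : subgraph H | is_cycle C && (e \in eset C)]) => [C|noC].
  case/andP=> cC eC; apply: (IH _ _ (card _ eC)).
  apply: (grow_cycle g cC (grow_cycle_meet g cC eC neE euw uX)).
  by case: (grow_saturated g cC) => // /subsetP/(_ e eC); rewrite (negPf neE).
have ne C : is_cycle C -> e \notin eset C.
  by move=> cC; have /negbT := noC C; rewrite /= cC.
apply: (IH (w |: X) (E :|: [set e])); first by apply: card; rewrite inE.
rewrite [E :|: _]setUC; apply: (grow_bridge g uX) => //; exact: (grow_bridge_new g ne neE euw uX).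
Qed.

End Walks.

(** * Strands, and barbells made of two strands *)

Section Families.
Variables (H : multigraph) (s : edge H -> bool).
Implicit Types (u v w x y : vertex H) (e f : edge H) (k n : nat).
Implicit Types (P X Y : {set vertex H}) (S T E Z K : {set edge H}).
Implicit Types (C D : subgraph H) (q : {set edge H} -> Prop).

(** Half a barbell, called a strand above: a negative cycle [D] with a path from [v] to it, inside
    the vertex region [Y]. Only [D] is confined to the edge region [Z], since a barbell asks for
    edge-disjointness of its two cycles alone. *)
Definition lollipop v Y Z T : Prop := exists D x P S,
  [/\ negative_cycle s D, eset D \subset Z & vset D \subset Y] /\
  [/\ link v x P S, P \subset Y, P :&: vset D = [set x] & T = eset D :|: S].

Definition circuit_edges T : Prop := exists2 B, circuit s B & eset B = T.

Lemma lollipop_root v Y Z T : lollipop v Y Z T -> v \in Y.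
Proof.
case=> D [x [P [S [_ [/link_ends/andP[vP _] /subsetP PY _ _]]]]]; exact: PY.
Qed.

Lemma lollipopS v Y Z Y' Z' T : Y \subset Y' -> Z \subset Z' ->
  lollipop v Y Z T -> lollipop v Y' Z' T.
Proof.
move=> sY sZ [D [x [P [S [[nD DZ DY] [l PY PD ->]]]]]]; exists D, x, P, S.
by split; split=> //; [apply: subset_trans sZ|apply: subset_trans sY|apply: subset_trans sY].
Qed.

(** A vertex of [P] in [Y'] lies in [Y], hence is [v], which [P'] contains already: prolonging a
    path creates no new contact with the cycle. *)
Lemma path_meets v P Y P' Y' x : P :&: Y \subset [set v] -> v \in P' ->
  Y' \subset Y -> P' :&: Y' = [set x] -> (P :|: P') :&: Y' = [set x].
Proof.
move=> /subsetP PY vP' /subsetP Y'Y eqx; rewrite setIUl eqx; apply/setUidPr.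
rewrite -eqx; apply/subsetP=> y; rewrite !inE => /andP[yP yY'].
have : y \in [set v] by apply: PY; rewrite inE yP Y'Y.
by rewrite inE => /eqP->; rewrite vP' -(set1P (PY y _)) ?inE ?yP ?Y'Y.
Qed.

Lemma lollipop_link u v P S Y Z T : link u v P S -> P :&: Y \subset [set v] ->
  lollipop v Y Z T -> lollipop u (P :|: Y) Z (S :|: T).
Proof.
move=> l PY [D [x [P' [S' [[nD DZ DY] [l' P'Y P'D ->]]]]]].
have /andP[vP' _] := link_ends l'.
exists D, x, (P :|: P'), (S :|: S'); split; split=> //.
- by rewrite subsetU ?DY ?orbT.
- by apply: link_cat l l' _; apply: subset_trans PY; apply: setIS.
- exact: setUS.
- exact: (path_meets PY vP' DY P'D).
by rewrite setUCA.
Qed.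

(** Two strands ending at [v] form a barbell: as the regions meet at most in [v], the two paths
    concatenate to a simple path that touches each cycle only at its end. *)
Lemma lollipop_join v Y1 Z1 T1 Y2 Z2 T2 :
  Y1 :&: Y2 \subset [set v] -> [disjoint Z1 & Z2] ->
  lollipop v Y1 Z1 T1 -> lollipop v Y2 Z2 T2 -> circuit_edges (T1 :|: T2).
Proof.
move=> dY dZ [D1 [x1 [P1 [S1 [[n1 DZ1 DY1] [l1 PY1 PD1 ->]]]]]].
move=> [D2 [x2 [P2 [S2 [[n2 DZ2 DY2] [l2 PY2 PD2 ->]]]]]].
have /andP[vP1 _] := link_ends l1; have /andP[vP2 _] := link_ends l2.
have l := link_cat (link_sym l1) l2 (subset_trans (setISS PY1 PY2) dY).
have dD : [disjoint eset D1 & eset D2].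
  exact: disjointWl DZ1 (disjointWr DZ2 dZ).
case: l => p [ip ep eP eS].
exists (union (union D1 D2) (path_graph x1 p)); last first.
  by rewrite /union /eset /= -eS setUACA.
right; exists D1, D2, x1, p; split; split=> //; rewrite /vset /= -eP ?ep.
  rewrite setUC; apply: (path_meets _ vP1 DY1 PD1).
  by apply: subset_trans dY; rewrite setIC; apply: setIS.
by apply: (path_meets _ vP2 DY2 PD2); apply: subset_trans dY; apply: setSI.
Qed.

Lemma lollipop_cycle C w : negative_cycle s C -> w \in vset C ->
  lollipop w (vset C) (eset C) (eset C).
Proof.
move=> nC wC; exists C, w, [set w], set0; split; split=> //; rewrite ?setU0 //.
- exact: link_refl.
- by rewrite sub1set.
by apply/setIidPl; rewrite sub1set.
Qed.

(** * Families of circuits with pending strands *)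

(* [family Q k K]: circuits, together with one edge set for each of the predicates
   in Q, have total length at most k and cover K. *)
Fixpoint family (Q : seq ({set edge H} -> Prop)) k K : Prop :=
  if Q is q :: Q' then
    exists T, [/\ q T, #|T| <= k & family Q' (k - #|T|) (K :\: T)]
  else exists F, [/\ forall T, T \in F -> circuit_edges T, \sum_(T <- F) #|T| <= k
                   & K \subset \bigcup_(T <- F) T].

Fixpoint implies (Q Q' : seq ({set edge H} -> Prop)) : Prop :=
  match Q, Q' with
  | [::], [::] => True
  | q :: Q1, q' :: Q1' => (forall T, q T -> q' T) /\ implies Q1 Q1'
  | _, _ => False
  end.

Lemma implies_refl Q : implies Q Q.
Proof. by elim: Q. Qed.

Lemma family_implies Q Q' k k' K K' : implies Q Q' -> k <= k' -> K' \subset K ->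
  family Q k K -> family Q' k' K'.
Proof.
elim: Q Q' k k' K K' => [|q Q IH] [|q' Q'] //= k k' K K'.
  move=> _ lek sK [F [cF leF sF]]; exists F; split=> //; first exact: leq_trans lek.
  exact: subset_trans sF.
case=> qq' QQ' lek sK [T [qT leT fam]]; exists T; split; first exact: qq'.
  exact: leq_trans lek.
by apply: IH QQ' _ _ fam; [apply: leq_sub2r | apply: setSD].
Qed.

Lemma familyS Q k k' K K' : k <= k' -> K' \subset K ->
  family Q k K -> family Q k' K'.
Proof. by apply: family_implies; apply: implies_refl. Qed.

Lemma family_swap q1 q2 Q k K : family (q1 :: q2 :: Q) k K -> family (q2 :: q1 :: Q) k K.
Proof.
case=> T1 [qT1 le1 [T2 [qT2 le2 fam]]]; exists T2; split=> //; first lia.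
exists T1; split=> //; first lia.
by move: fam; apply: familyS; [lia | rewrite !setDDl setUC].
Qed.

Lemma family_head q Q1 Q2 k K : family (Q1 ++ q :: Q2) k K -> family (q :: Q1 ++ Q2) k K.
Proof.
elim: Q1 k K => [//|q1 Q1 IH] k K /= [T [qT leT /IH fam]].
by apply: family_swap; exists T.
Qed.

Lemma family_cat Q1 Q2 k1 k2 K1 K2 : family Q1 k1 K1 -> family Q2 k2 K2 ->
  family (Q1 ++ Q2) (k1 + k2) (K1 :|: K2).
Proof.
elim: Q1 k1 K1 => [|q Q1 IH] k1 K1 /=; last first.
  case=> T [qT leT fam1] fam2; exists T; split=> //; first lia.
  move: (IH _ _ fam1 fam2); apply: familyS; first lia.
  by rewrite setDUl setUS // subsetDl.
case=> F1 [cF1 leF1 sF1]; elim: Q2 k2 K2 => [|q Q2 IH] k2 K2 /=.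
  case=> F2 [cF2 leF2 sF2]; exists (F1 ++ F2); split.
  - by move=> T; rewrite mem_cat => /orP[/cF1|/cF2].
  - by rewrite big_cat leq_add.
  by rewrite big_cat setUSS.
case=> T [qT leT fam]; exists T; split=> //; first lia.
move: (IH _ _ fam); apply: familyS; first lia.
by rewrite setDUl setSU // subsetDl.
Qed.

(** For prolonging a pending set along [E] at the price of [c] further edges. *)
Lemma family_map q q' Q c E k K :
    (forall T, q T -> exists T', [/\ q' T', #|T'| <= #|T| + c & E :|: T \subset T']) ->
  family (q :: Q) k K -> family (q' :: Q) (k + c) (E :|: K).
Proof.
move=> qq' [T [/qq'[T' [qT' leT' sT']] leT fam]]; exists T'; split=> //; first lia.
move: fam; apply: familyS; first lia.
rewrite setDUl subUset; apply/andP; split.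
  apply/subsetP=> e; rewrite !inE => /andP[neT' eE]; case/negP: neT'.
  by apply: (subsetP sT'); rewrite inE eE.
by rewrite setDS //; apply: subset_trans sT'; apply: subsetUr.
Qed.

(** For joining two pending sets into one along [E], at the price of [c] further edges. *)
Lemma family_join q1 q2 q Q c E k K :
    (forall T1 T2, q1 T1 -> q2 T2 -> exists T,
      [/\ q T, #|T| <= #|T1| + #|T2| + c & E :|: (T1 :|: T2) \subset T]) ->
  family (q1 :: q2 :: Q) k K -> family (q :: Q) (k + c) (E :|: K).
Proof.
move=> jn [T1 [qT1 le1 [T2 [qT2 le2 fam]]]].
have [T [qT leT sT]] := jn _ _ qT1 qT2; exists T; split=> //; first lia.
move: fam; apply: familyS; first lia.
rewrite setDUl setDDl subUset; apply/andP; split.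
  apply/subsetP=> e; rewrite !inE => /andP[neT eE]; case/negP: neT.
  by apply: (subsetP sT); rewrite inE eE.
by rewrite setDS //; apply: subset_trans sT; apply: subsetUr.
Qed.

Lemma family_add q T Q k K : q T -> family Q k K ->
  family (q :: Q) (k + #|T|) (K :|: T).
Proof.
move=> qT fam; exists T; split=> //; first lia.
by move: fam; apply: familyS; [lia | rewrite setDUl setDv setU0 subsetDl].
Qed.

(** A pending set that has become a circuit moves into the finished part of the family. *)
Lemma family_circuit Q k K : family (circuit_edges :: Q) k K -> family Q k K.
Proof.
elim: Q k K => [|q Q IH] k K.
  case=> T [cT leT [F [cF leF sF]]]; exists (T :: F); split.
  - by move=> T'; rewrite inE => /orP[/eqP->|/cF].
  - by rewrite big_cons; lia.
  by rewrite big_cons -subDset.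
by case/family_swap=> T [qT leT /IH fam]; exists T.
Qed.

(** The source of the factor one half: of two alternatives with total extra length at most [n], the
    shorter one costs at most half of [n]. *)
Lemma family_min Q k a b n K : a + b <= n ->
    family Q (k + a) K -> family Q (k + b) K ->
  exists2 m, m.*2 <= n & family Q (k + m) K.
Proof.
move=> le fa fb; have [ab|ba] := leqP a b; first by exists a => //; lia.
by exists b => //; lia.
Qed.

(** * Cycle edges and the parity of the number of negative cycles *)

Hypothesis edc : edge_disjoint_cycles H.

Definition cycle_edges Z : {set edge H} :=
  [set e in Z | [exists C : subgraph H, is_cycle C && (e \in eset C)]].

Definition negative_parity Z : bool :=
  odd #|[set C : subgraph H | negative_cycle s C && (eset C \subset Z)]|.

Lemma cycle_edgesU Z1 Z2 : cycle_edges (Z1 :|: Z2) = cycle_edges Z1 :|: cycle_edges Z2.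
Proof. by apply/setP=> e; rewrite !inE andb_orl. Qed.

Lemma cycle_edges_cycle C : is_cycle C -> cycle_edges (eset C) = eset C.
Proof.
move=> cC; apply/setP=> e; rewrite inE; case eC: (e \in eset C) => //=.
by apply/existsP; exists C; rewrite cC.
Qed.

Lemma cycle_edges_bridge e : (forall C, is_cycle C -> e \notin eset C) ->
  cycle_edges [set e] = set0.
Proof.
move=> ne; apply/setP=> f; rewrite !inE; apply/andP=> -[/eqP-> /existsP[C /andP[cC]]].
exact/negP/ne.
Qed.

Lemma cycle_edges0 : cycle_edges set0 = set0.
Proof. by apply/setP=> e; rewrite !inE. Qed.

Lemma cycle_has_edge C : is_cycle C -> exists e, e \in eset C.
Proof.
move=> cC; have /and3P[_ /andP[/set0Pn[v vC] _] _] := cC.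
by have [e [u [eC _]]] := cycle_edge_at cC vC; exists e.
Qed.

Lemma negative_is_cycle C : negative_cycle s C -> is_cycle C.
Proof. by case/andP. Qed.

(** Saturation puts every negative cycle of the union on one side, and a cycle has an edge, so none
    is counted on both sides. *)
Lemma negative_parityU Z1 Z2 : saturated Z1 -> [disjoint Z1 & Z2] ->
  negative_parity (Z1 :|: Z2) = negative_parity Z1 (+) negative_parity Z2.
Proof.
move=> s1 d12; rewrite /negative_parity -oddD -cardsUI.
set A1 := [set C : subgraph H | _ && (eset C \subset Z1)].
set A2 := [set C : subgraph H | _ && (eset C \subset Z2)].
have -> : A1 :&: A2 = set0.
  apply/setP=> C; rewrite !inE; apply/andP=> -[/andP[nC C1] /andP[_ C2]].
  have [e eC] := cycle_has_edge (negative_is_cycle nC).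
  by have /pred0P/(_ e) := d12; rewrite /= (subsetP C1) ?(subsetP C2).
rewrite cards0 addn0; congr (odd #|pred_of_set _|); apply/setP=> C; rewrite !inE -andb_orr.
case nC: (negative_cycle s C) => //=; apply/idP/orP=> [CZ|[]]; last first.
- by move=> CZ; rewrite subsetU // CZ orbT.
- by move=> CZ; rewrite subsetU // CZ.
case: (s1 C (negative_is_cycle nC)) => [|dC]; [by left | right].
apply/subsetP=> e eC; have := subsetP CZ e eC; rewrite inE.
by have /pred0P/(_ e) := dC; rewrite /= eC => /= ->.
Qed.

Lemma negative_parity0 : negative_parity set0 = false.
Proof.
rewrite /negative_parity (_ : [set C | _] = set0) ?cards0 //.
apply/setP=> C; rewrite !inE subset0; apply/andP=> -[/negative_is_cycle/cycle_has_edge[e]].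
by move=> eC /eqP C0; rewrite C0 inE in eC.
Qed.

Lemma negative_parity_bridge e : (forall C, is_cycle C -> e \notin eset C) ->
  negative_parity [set e] = false.
Proof.
move=> ne; rewrite /negative_parity (_ : [set C | _] = set0) ?cards0 //.
apply/setP=> C; rewrite !inE; apply/andP=> -[/negative_is_cycle cC].
have [f fC] := cycle_has_edge cC => /subsetP/(_ f fC); rewrite inE => /eqP fe.
by have := ne C cC; rewrite -fe fC.
Qed.

Lemma negative_parity_cycle C : is_cycle C ->
  negative_parity (eset C) = negative_cycle s C.
Proof.
move=> cC; rewrite /negative_parity.
rewrite (_ : [set D | _] = if negative_cycle s C then [set C] else set0).
  by case: ifP; rewrite ?cards1 ?cards0.
apply/setP=> D; rewrite !inE; apply/andP/idP=> [[nD /subsetP DC]|].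
  have cD := negative_is_cycle nD; have [e eD] := cycle_has_edge cD.
  have DeqC := cycle_unique edc cD cC eD (DC _ eD).
  by rewrite -DeqC nD inE.
by case nC: (negative_cycle s C); rewrite inE // => /eqP ->.
Qed.

(** * Solved parts, merged at a vertex or moved over a bridge *)

(* An odd part sends one strand to its root v in the first family and two strands
   in the second one. *)
Definition solved v Y Z : Prop :=
  [/\ v \in Y, saturated Z & exists k1 k2,
    [/\ family (nseq (negative_parity Z) (lollipop v Y Z)) k1 (cycle_edges Z),
        family (nseq (negative_parity Z).*2 (lollipop v Y Z)) k2 (cycle_edges Z)
      & 2 * k1 + k2 <= 4 * #|Z|]].

Lemma solved_vertex v : solved v [set v] set0.
Proof.
split; [by rewrite inE | exact: saturated0 | exists 0, 0].
rewrite negative_parity0 cycle_edges0 cards0.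
by split=> //=; exists [::]; rewrite !big_nil sub0set; split.
Qed.

Lemma implies_nseq q q' n : (forall T, q T -> q' T) -> implies (nseq n q) (nseq n q').
Proof. by move=> qq'; elim: n => //= n IH; split. Qed.

(** The [n] strands of one side are matched with those of the other; [n] is 1 or 2 when two odd
    parts meet. *)
Lemma family_join_all q1 q2 n Q k K :
    (forall T1 T2, q1 T1 -> q2 T2 -> circuit_edges (T1 :|: T2)) ->
  family (nseq n q1 ++ nseq n q2 ++ Q) k K -> family Q k K.
Proof.
move=> jn; elim: n => //= n IH fam.
have /family_swap fam2 : family (q2 :: q1 :: nseq n q1 ++ nseq n q2 ++ Q) k K.
  exact: (@family_head _ (q1 :: nseq n q1)).
apply: IH; apply: family_circuit; rewrite -(addn0 k) -(set0U K).
apply: family_join fam2 => T1 T2 q1T q2T; exists (T1 :|: T2).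
split; [exact: jn | by rewrite addn0 leq_card_setU | by rewrite set0U].
Qed.

(** If both parts are odd, their strands meet at [v] and are joined in pairs; otherwise the strands
    of the odd part, if any, stay open. The lengths just add up. *)
Lemma solved_merge v Y1 Z1 Y2 Z2 : Y1 :&: Y2 \subset [set v] -> [disjoint Z1 & Z2] ->
  solved v Y1 Z1 -> solved v Y2 Z2 -> solved v (Y1 :|: Y2) (Z1 :|: Z2).
Proof.
move=> dY dZ [vY1 s1 [k1 [l1 [f1 g1 le1]]]] [vY2 s2 [k2 [l2 [f2 g2 le2]]]].
split; [by rewrite inE vY1 | exact: saturatedU | exists (k1 + k2), (l1 + l2)].
rewrite negative_parityU // cycle_edgesU cardsU disjoint_setI0 // cards0.
set q := lollipop v (Y1 :|: Y2) (Z1 :|: Z2).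
have i1 T : lollipop v Y1 Z1 T -> q T by apply: lollipopS; apply: subsetUl.
have i2 T : lollipop v Y2 Z2 T -> q T by apply: lollipopS; apply: subsetUr.
have jn T1 T2 : lollipop v Y1 Z1 T1 -> lollipop v Y2 Z2 T2 ->
  circuit_edges (T1 :|: T2) by apply: lollipop_join.
have both n1 n2 k l K L : family (nseq n1 (lollipop v Y1 Z1)) k K ->
    family (nseq n2 (lollipop v Y2 Z2)) l L ->
  family (nseq (n1 + n2) q) (k + l) (K :|: L).
  move=> fam1 fam2; apply: family_implies (family_cat fam1 fam2) => //.
  rewrite nseqD; elim: n1 {fam1} => [|n1 IH]; last by split.
  exact: implies_nseq.
have pair n k l K L : family (nseq n (lollipop v Y1 Z1)) k K ->
    family (nseq n (lollipop v Y2 Z2)) l L -> family [::] (k + l) (K :|: L).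
  move=> fam1 fam2; apply: (@family_join_all _ _ n _ _ _ jn); rewrite cats0.
  exact: family_cat.
split; last by lia.
  by move: f1 f2; case: (negative_parity Z1); case: (negative_parity Z2);
    [exact: (pair 1) | exact: (both 1 0) | exact: (both 0 1) | exact: (both 0 0)].
by move: g1 g2; case: (negative_parity Z1); case: (negative_parity Z2);
  [exact: (pair 2) | exact: (both 2 0) | exact: (both 0 2) | exact: (both 0 0)].
Qed.

Lemma family_map_all q q' n c E k K :
    (forall T, q T -> exists T', [/\ q' T', #|T'| <= #|T| + c & E :|: T \subset T']) ->
  family (nseq n q) k K -> family (nseq n q') (k + n * c) K.
Proof.
move=> qq'; elim: n k K => [|n IH] k K /=; first by rewrite addn0.
case=> T [/qq'[T' [qT' leT' sT']] leT fam]; exists T'; split=> //; first lia.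
move: (IH _ _ fam); apply: familyS; first by rewrite mulSn; lia.
by apply: setDS; apply: subset_trans sT'; apply: subsetUr.
Qed.

(** Every open strand is prolonged by [e]. For an odd part this costs 1 in the first family and 2 in
    the second, and [2 * 1 + 2] is the allowance 4 for one edge. *)
Lemma solved_bridge v w e Y Z : joins e v w -> v \notin Y -> e \notin Z ->
    (forall C, is_cycle C -> e \notin eset C) ->
  solved w Y Z -> solved v (v |: Y) (e |: Z).
Proof.
move=> evw vY eZ ne [wY sZ [k1 [k2 [f1 f2 le]]]].
have vw : v != w by apply: contraNneq vY => ->.
have d1 : [disjoint [set e] & Z] by rewrite disjoints1.
split; [exact: setU11 | exact: saturatedU (saturated_bridge ne) sZ |].
rewrite negative_parityU //; last exact: saturated_bridge.
rewrite negative_parity_bridge // cycle_edgesU cycle_edges_bridge // set0U addFb.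
have ext T : lollipop w Y Z T -> exists T', [/\ lollipop v (v |: Y) (e |: Z) T',
    #|T'| <= #|T| + 1 & set0 :|: T \subset T'].
  move=> lT; exists (e |: T); split; last by rewrite set0U subsetUr.
    have: lollipop v ([set v; w] :|: Y) Z (e |: T).
      apply: lollipop_link lT; first exact: link_step.
      apply/subsetP=> y; rewrite !inE => /andP[/orP[/eqP->|//]].
      by rewrite (negPf vY).
    apply: lollipopS (subsetUr _ _); apply/subsetP=> y; rewrite !inE -orbA.
    by case/or3P=> [->//|/eqP->|->]; rewrite ?wY orbT.
  by rewrite cardsU1 addnC leq_add2l leq_b1.
exists (k1 + negative_parity Z * 1), (k2 + (negative_parity Z).*2 * 1).
split; [exact: (family_map_all ext f1) | exact: (family_map_all ext f2) |].
by rewrite cardsU1 eZ; case: (negative_parity Z) {f1 f2}; lia.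
Qed.

(** * Strands travelling along a cycle *)

Arguments family : simpl never.

(* A lollipop that reaches v by walking along the path (P, S), and is otherwise
   disjoint from P; if (P, S) is part of a negative cycle, then its part off the
   path can be joined to this cycle. *)
Definition hooked P S v Y Z T : Prop := exists w P1 S1 Y0 T0,
  [/\ link v w P1 S1, P1 \subset P & S1 \subset S] /\
  [/\ lollipop w Y0 Z T0, Y0 :&: P = [set w], P1 :|: Y0 \subset Y & T = S1 :|: T0].

Lemma hooked_lollipop P S v Y Z T : hooked P S v Y Z T -> lollipop v Y Z T.
Proof.
case=> w [P1 [S1 [Y0 [T0 [[l sP sS] [lT eY sY ->]]]]]].
apply: lollipopS sY (subxx _) _; apply: lollipop_link l _ lT.
by rewrite -eY setIC; apply: setIS.
Qed.

(** The walk advances to a vertex [w] off the region of the strand, while the strand stays at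
    [v]. *)
Lemma hooked_widen P S v Y Z T e w : w \notin Y -> hooked P S v Y Z T ->
  hooked (w |: P) (e |: S) v Y Z T.
Proof.
move=> wY [x [P1 [S1 [Y0 [T0 [[l sP sS] [lT eY sY ->]]]]]]].
exists x, P1, S1, Y0, T0; split; split=> //.
- exact: subset_trans sP (subsetUr _ _).
- exact: subset_trans sS (subsetUr _ _).
rewrite -eY setIUr; apply/setUidPr; apply/subsetP=> y; rewrite !inE.
case/andP=> yY0 /eqP yw; move: wY; rewrite -yw => /negP[].
by apply: (subsetP sY); rewrite inE yY0 orbT.
Qed.

Lemma hooked_step P S u Y Z T e w : joins e u w -> w \notin Y ->
  hooked P S u Y Z T -> hooked (w |: P) (e |: S) w (w |: Y) Z (e |: T).
Proof.
move=> euw wY hT; have [x [P1 [S1 [Y0 [T0 [[l sP sS] [lT eY sY ->]]]]]]] := hT.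
have /andP[uP1 _] := link_ends l.
have uw : w != u.
  by apply: contraNneq wY => ->; apply: (subsetP sY); rewrite inE uP1.
rewrite joinsC in euw; have lwx : link w x (w |: P1) (e |: S1).
  have -> : w |: P1 = [set w; u] :|: P1 by rewrite -setUA (setUidPr (_ : [set u] \subset P1)) ?sub1set.
  apply: link_cat (link_step euw uw) l _.
  apply/subsetP=> y; rewrite !inE => /andP[/orP[/eqP->|//] wP1].
  by case/negP: wY; apply: (subsetP sY); rewrite inE wP1.
have eY' : Y0 :&: (w |: P) = [set x].
  rewrite -eY setIUr; apply/setUidPr; apply/subsetP=> y; rewrite !inE.
  case/andP=> yY0 /eqP yw; move: wY; rewrite -yw => /negP[].
  by apply: (subsetP sY); rewrite inE yY0 orbT.
exists x, (w |: P1), (e |: S1), Y0, T0; split; split=> //; rewrite ?setUA //.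
- exact: setUS.
- exact: setUS.
by rewrite -setUA setUS.
Qed.

Lemma hooked_new P S w Y Z T e : w \in Y -> [disjoint Y & P] -> lollipop w Y Z T ->
  hooked (w |: P) (e |: S) w Y Z T.
Proof.
move=> wY dYP lT; exists w, [set w], set0, Y, T; split; split=> //.
- exact: link_refl.
- exact: subsetUl.
- exact: sub0set.
- rewrite setIUr (disjoint_setI0 dYP) setU0.
  by apply/setIidPr; rewrite sub1set.
- by rewrite subUset sub1set wY subxx.
by rewrite set0U.
Qed.

(** The strand leaves the cycle at [x]. Its part off the cycle and [C] form a barbell through [x],
    which contains the arc travelled by the strand because that arc lies on [C]. *)
Lemma hooked_circuit C P S v Y Z T : negative_cycle s C -> vset C = P ->
    S \subset eset C -> [disjoint Z & eset C] -> hooked P S v Y Z T ->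
  exists T', [/\ circuit_edges T', #|T'| <= #|T| + #|eset C| & eset C :|: T \subset T'].
Proof.
move=> nC CP SC dZC [x [P1 [S1 [Y0 [T0 [[l sP sS] [lT eY sY ->]]]]]]].
have xC : x \in vset C by rewrite CP -sub1set -eY subsetIr.
exists (T0 :|: eset C); split.
- apply: (lollipop_join _ dZC lT (lollipop_cycle nC xC)).
  by rewrite CP eY.
- apply: leq_trans (leq_card_setU _ _) _; rewrite leq_add2r.
  by apply: subset_leq_card; apply: subsetUr.
by rewrite setUA (setUidPl (subset_trans sS SC)) setUC.
Qed.

(* Along a cycle, the odd subtrees are joined consecutively.  Taking every second
   arc gives two alternatives for the one-strand solution, and taking all arcs
   gives the two-strand solution; in all of them the first and the last odd
   subtree may keep a strand, ending at v and at the current vertex u. *)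
Definition opened P S v u X1 Z1 X2 Z2 (p : bool) k1 k2 K : Prop :=
  family [:: hooked P S v X1 Z1; hooked P S u X2 Z2] (k2 + #|S|) (S :|: K) /\
  exists a b, [/\ a + b <= #|S|,
    family (nseq p (hooked P S u X2 Z2)) (k1 + a) K
  & family (hooked P S v X1 Z1 :: nseq (~~ p) (hooked P S u X2 Z2)) (k1 + b) K].

(** An odd subtree at [w]. In the two-strand solution, one of its strands closes the strand coming
    from [u] and the other becomes the last open one. In the one-strand solution, the alternative
    with a strand at [u] carries it over [e] and closes it; the other opens the strand of [w]. *)
Lemma opened_odd P S v u X1 Z1 X2 Z2 p k1 k2 K e w Y Z l1 l2 L :
    joins e u w -> e \notin S -> w \notin X1 -> w \in Y ->
    [disjoint Y & P] -> [disjoint X2 & Y] -> [disjoint Z2 & Z] ->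
    family [:: lollipop w Y Z] l1 L ->
    family [:: lollipop w Y Z; lollipop w Y Z] l2 L ->
  opened P S v u X1 Z1 X2 Z2 p k1 k2 K ->
  opened (w |: P) (e |: S) v w X1 Z1 Y Z (~~ p) (k1 + l1) (k2 + l2) (K :|: L).
Proof.
move=> euw eS wX1 wY dYP dX2 dZ2 f1 f2 [g2 [a [b [lab ga gb]]]].
have wX2 : w \notin X2.
  by apply/negP=> wX2; have /pred0P/(_ w) := dX2; rewrite /= wX2 wY.
set hL := hooked P S v X1 Z1 in g2 gb *; set hR := hooked P S u X2 Z2 in g2 ga gb *.
pose hL' := hooked (w |: P) (e |: S) v X1 Z1.
pose hR' := hooked (w |: P) (e |: S) w Y Z.
set q := lollipop w Y Z in f1 f2.
have LL T : hL T -> hL' T by apply: hooked_widen.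
have qR T : q T -> hR' T by apply: hooked_new.
have Rq T1 T2 : hR T1 -> q T2 -> exists T, [/\ circuit_edges T,
    #|T| <= #|T1| + #|T2| + 1 & [set e] :|: (T1 :|: T2) \subset T].
  move=> h1 q2; exists ((e |: T1) :|: T2); split; last by rewrite setUA.
    apply: lollipop_join dZ2 (hooked_lollipop (hooked_step euw wX2 h1)) q2.
    by rewrite setIUl (disjoint_setI0 dX2) setU0 subsetIl.
  by have [+ _] := leq_card_setU (e |: T1) T2; rewrite cardsU1; case: (e \notin T1) => /=; lia.
have join Q k M : family [:: hR, q & Q] k M -> family Q (k + 1) (e |: M).
  by move=> /(family_join Rq)/family_circuit.
rewrite /opened cardsU1 eS; split.
  have /(@family_head q [:: hR; hL])/family_swap/join g := family_swap (family_cat g2 f2).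
  apply: family_implies g; [by split=> //; split | lia | by rewrite !setUA subxx].
(* The edge [e] is charged to exactly one alternative: the first if [p] holds, the second
   otherwise. *)
exists (a + p * 1), (b + ~~ p * 1); split.
- by case: p {ga gb}; lia.
- have := family_cat ga f1; case: p {ga gb} => /=.
    move=> /join; apply: familyS; first lia.
    exact: subsetUr.
  by apply: family_implies; [split | lia | ].
have := family_cat gb f1; case: p {ga gb} => /=.
  by apply: family_implies; [split=> //; split | lia | ].
move=> /family_swap/(@family_head q [:: hR; hL])/family_swap/join.
by apply: family_implies; [split | lia | exact: subsetUr].
Qed.

(** An even subtree at [w] sends out nothing, so an open strand at [u] just moves over [e]. *)
Lemma opened_even P S v u X1 Z1 X2 Z2 p k1 k2 K e w l1 l2 L :
    joins e u w -> e \notin S -> w \notin X1 -> w \notin X2 ->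
    family [::] l1 L -> family [::] l2 L ->
  opened P S v u X1 Z1 X2 Z2 p k1 k2 K ->
  opened (w |: P) (e |: S) v w X1 Z1 (w |: X2) Z2 p (k1 + l1) (k2 + l2) (K :|: L).
Proof.
move=> euw eS wX1 wX2 f1 f2 [g2 [a [b [lab ga gb]]]].
set hL := hooked P S v X1 Z1 in g2 gb *; set hR := hooked P S u X2 Z2 in g2 ga gb *.
pose hL' := hooked (w |: P) (e |: S) v X1 Z1.
pose hR' := hooked (w |: P) (e |: S) w (w |: X2) Z2.
have LL T : hL T -> hL' T by apply: hooked_widen.
have RR T : hR T -> exists T', [/\ hR' T', #|T'| <= #|T| + 1 & [set e] :|: T \subset T'].
  move=> hT; exists (e |: T); split=> //; first exact: (hooked_step euw wX2 hT).
  by rewrite cardsU1 addnC leq_add2l leq_b1.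
rewrite /opened cardsU1 eS; split.
  have /family_swap/(family_map RR)/family_swap g := family_cat g2 f2.
  by apply: family_implies g; [split | lia | by rewrite !setUA subxx].
exists (a + p * 1), (b + ~~ p * 1); split.
- by case: p {ga gb}; lia.
- have := family_cat ga f1; case: p {ga gb} => /=.
    by move=> /(family_map RR); apply: familyS; [lia | exact: subsetUr].
  by apply: familyS; first lia.
have := family_cat gb f1; case: p {ga gb} => /=.
  by apply: family_implies; [split | lia | ].
move=> /family_swap/(family_map RR)/family_swap.
by apply: family_implies; [split | lia | exact: subsetUr].
Qed.

(** The state with one odd subtree, at [x], whose strands are not yet sent anywhere; [P1] and [P2]
    lead to [x] from [v] and from [u]. The choice is delayed because a negative cycle without
    further odd subtrees takes the strands at [x] itself. *)
Definition single_odd P S v u X Z k1 k2 : Prop := exists x Y P1 S1 P2 S2,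
  [/\ link v x P1 S1, link u x P2 S2, P1 :&: P2 \subset [set x] & P1 :|: P2 \subset P] /\
  [/\ S = S1 :|: S2, #|S1| + #|S2| <= #|S|, v != x & Y :&: P = [set x]] /\
  [/\ Y \subset X, family [:: lollipop x Y Z] k1 (cycle_edges Z)
    & family [:: lollipop x Y Z; lollipop x Y Z] k2 (cycle_edges Z)].

(** The strands are released from [x] towards [v] and towards [u]. Both come from [Z] and may end in
    the same cycle, so they are not joined to each other. *)
Lemma single_odd_opened P S v u X Z k1 k2 : single_odd P S v u X Z k1 k2 ->
  P \subset X -> exists X1 X2, [/\ X1 \subset X, X2 \subset X, v \notin X2
    & opened P S v u X1 Z X2 Z true k1 k2 (cycle_edges Z)].
Proof.
case=> x [Y [P1 [S1 [P2 [S2 [[l1 l2 P12 P12P] [[eS cS vx eY] [YX f1 f2]]]]]]]] PX.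
move: P12P; rewrite subUset => /andP[P1P P2P].
have /andP[vP1 _] := link_ends l1.
exists (P1 :|: Y), (P2 :|: Y); split.
- by rewrite subUset YX (subset_trans P1P PX).
- by rewrite subUset YX (subset_trans P2P PX).
- apply/negP; rewrite inE => /orP[vP2|vY].
    have : v \in [set x] by apply: (subsetP P12); rewrite inE vP1.
    by rewrite inE (negPf vx).
  have : v \in [set x] by rewrite -eY inE vY (subsetP P1P).
  by rewrite inE (negPf vx).
set q := lollipop x Y Z in f1 f2.
pose hL := hooked P S v (P1 :|: Y) Z; pose hR := hooked P S u (P2 :|: Y) Z.
have qL T : q T -> exists T', [/\ hL T', #|T'| <= #|T| + #|S1| & S1 :|: T \subset T'].
  move=> qT; exists (S1 :|: T); split=> //.
    exists x, P1, S1, Y, T; split; split=> //.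
    by rewrite eS subsetUl.
  by rewrite addnC leq_card_setU.
have qR T : q T -> exists T', [/\ hR T', #|T'| <= #|T| + #|S2| & S2 :|: T \subset T'].
  move=> qT; exists (S2 :|: T); split=> //.
    exists x, P2, S2, Y, T; split; split=> //.
    by rewrite eS subsetUr.
  by rewrite addnC leq_card_setU.
split.
  have /family_swap/(family_map qR)/family_swap g := family_map qL f2.
  by apply: familyS g; [lia | rewrite eS setUA [S1 :|: S2]setUC].
(* A single strand goes to [u] along [S2] in the first alternative and to [v] along [S1] in the
   second. *)
exists #|S2|, #|S1|; split; first by rewrite addnC.
  by apply: familyS (family_map qR f1); [ | exact: subsetUr].
by apply: familyS (family_map qL f1); [ | exact: subsetUr].
Qed.

(** The state after walking from [v] to [u]: no odd subtree so far, exactly one, or at least two. In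
    the last case the regions of the first and the last strand are disjoint, so that these can be
    joined when the cycle closes. *)
Definition chain v u P S X Z : Prop :=
  [/\ link v u P S, P \subset X, saturated Z & exists k1 k2, 2 * k1 + k2 <= 4 * #|Z| /\
    [\/ [/\ ~~ negative_parity Z, family [::] k1 (cycle_edges Z)
          & family [::] k2 (cycle_edges Z)],
       negative_parity Z /\ single_odd P S v u X Z k1 k2
     | exists X1 Z1 X2 Z2, [/\ X1 :|: X2 \subset X, [disjoint X1 & X2],
           Z1 :|: Z2 \subset Z, [disjoint Z1 & Z2]
         & opened P S v u X1 Z1 X2 Z2 (negative_parity Z) k1 k2 (cycle_edges Z)]]].

Lemma chain_root v : chain v v [set v] set0 [set v] set0.
Proof.
split=> //; [exact: link_refl | exact: saturated0 | exists 0, 0].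
rewrite cards0 negative_parity0 cycle_edges0; split=> //; constructor 1.
by split=> //; exists [::]; rewrite !big_nil sub0set; split.
Qed.

Lemma link_edge_ends v u P S e : link v u P S -> e \in S ->
  ((ends e).1 \in P) && ((ends e).2 \in P).
Proof.
by case=> p [/andP[wp _] _ -> ->]; rewrite !in_set; apply: walk_ends.
Qed.

Lemma chain_step v u P S X Z e w Y Z' : chain v u P S X Z -> joins e u w ->
    [disjoint Y & X] -> [disjoint Z & Z'] -> solved w Y Z' ->
  chain v w (w |: P) (e |: S) (X :|: Y) (Z :|: Z').
Proof.
move=> [l PX sZ [k1 [k2 [le st]]]] euw dYX dZ [wY sZ' [l1 [l2 [f1 f2 le']]]].
have wX : w \notin X by apply/negP=> wX; have /pred0P/(_ w) := dYX; rewrite /= wX wY.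
have /andP[vP uP] := link_ends l.
have wP : w \notin P by apply: contra wX; apply: (subsetP PX).
have uw : u != w by apply: contraNneq wP => <-.
have eS : e \notin S.
  apply: contra wP => /(link_edge_ends l); rewrite (joins_in _ euw) => /andP[] //.
have dYP : [disjoint Y & P] by apply: disjointWr dYX.
have lw : link v w (w |: P) (e |: S).
  have -> : w |: P = P :|: [set u; w].
    by rewrite setUA (setUidPl (_ : [set u] \subset P)) ?sub1set // setUC.
  rewrite [e |: S]setUC; apply: link_cat l (link_step euw uw) _.
  by apply/subsetP=> y; rewrite !inE => /andP[yP /orP[//|/eqP yw]]; rewrite -yw yP in wP.
split=> //.
- by rewrite subUset sub1set inE wY orbT /= subsetU // PX.
- exact: saturatedU.
exists (k1 + l1), (k2 + l2).
rewrite negative_parityU // cycle_edgesU cardsU disjoint_setI0 // cards0 subn0.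
split; first by rewrite mulnDr [4 * _]mulnDr addnACA leq_add.
case: st => [[/negPf np g1 g2]|[np so]|].
- rewrite np addFb; case: (negative_parity Z') f1 f2 => /= f1 f2; last first.
    by constructor 1; split=> //; apply: (family_cat (Q1 := [::]) (Q2 := [::])).
  constructor 2; split=> //.
  have i T : lollipop w Y Z' T -> lollipop w Y (Z :|: Z') T.
    by apply: lollipopS => //; apply: subsetUr.
  (* The first odd subtree: the way back to [v] is the whole path, the way ahead is trivial. *)
  exists w, Y, (w |: P), (e |: S), [set w], set0; split; first split=> //.
  + exact: link_refl.
  + exact: subsetIr.
  + by rewrite subUset subxx subsetUl.
  split; first split=> //; rewrite ?setU0 ?cards0 ?addn0 //.
  + by apply: contraNneq wP => <-.
  + rewrite setIUr (disjoint_setI0 dYP) setU0.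
    by apply/setIidPr; rewrite sub1set.
  split; first exact: subsetUr.
    by apply: family_implies (family_cat g1 f1); [split | | rewrite cycle_edgesU].
  by apply: family_implies (family_cat g2 f2); [split=> //; split | | rewrite cycle_edgesU].
- rewrite np addTb; case: (negative_parity Z') f1 f2 => /= f1 f2.
    (* The second odd subtree: the last strand now comes from [Z'], disjoint from the [Z] of the
       first. *)
    constructor 3; have [X1 [X2 [X1X X2X vX2 op]]] := single_odd_opened so PX.
    exists X1, Z, Y, Z'; split=> //.
    + by rewrite setSU.
    + by rewrite disjoint_sym; apply: disjointWr dYX.
    apply: (opened_odd euw eS _ wY dYP _ dZ f1 f2 op).
      by apply: contra wX; apply: (subsetP X1X).
    by rewrite disjoint_sym; apply: disjointWr dYX.
  constructor 2; split=> //.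
  have [x [Y0 [P1 [S1 [P2 [S2 [[m1 m2 P12 P12P] [[dS cS vx eY] [YX h1 h2]]]]]]]]] := so.
  have i T : lollipop x Y0 Z T -> lollipop x Y0 (Z :|: Z') T.
    by apply: lollipopS => //; apply: subsetUl.
  have P1P : P1 \subset P by apply: subset_trans P12P; apply: subsetUl.
  have P2P : P2 \subset P by apply: subset_trans P12P; apply: subsetUr.
  (* An even subtree makes only the way ahead longer. *)
  exists x, Y0, P1, S1, (w |: P2), (e |: S2); split; first split=> //.
  + have /andP[uP2 _] := link_ends m2; rewrite joinsC in euw.
    have -> : w |: P2 = [set w; u] :|: P2.
      by rewrite -setUA (setUidPr (_ : [set u] \subset P2)) ?sub1set.
    apply: link_cat (link_step euw _) m2 _; first by rewrite eq_sym.
    apply/subsetP=> y; rewrite !inE => /andP[/orP[/eqP->|//] wP2].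
    by rewrite (subsetP P2P) in wP.
  + rewrite setIUr subUset P12 andbT; apply/subsetP=> y; rewrite !inE.
    by case/andP=> yP1 /eqP yw; rewrite -yw (subsetP P1P) in wP.
  + by rewrite setUCA setUS.
  split; first split=> //.
  + by rewrite dS setUCA.
  + by rewrite !cardsU1 eS addnCA leq_add // leq_b1.
  + rewrite -eY setIUr; apply/setUidPr; apply/subsetP=> y; rewrite !inE.
    by case/andP=> yY0 /eqP yw; rewrite -yw (subsetP YX) in wX.
  split; first by rewrite subsetU // YX.
    by apply: family_implies (family_cat h1 f1); [split | | rewrite cycle_edgesU].
  by apply: family_implies (family_cat h2 f2); [split=> //; split | | rewrite cycle_edgesU].
case=> X1 [Z1 [X2 [Z2 [sX dX sZ12 dZ12 op]]]]; constructor 3.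
move: sX; rewrite subUset => /andP[X1X X2X].
move: sZ12; rewrite subUset => /andP[Z1Z Z2Z].
have wX1 : w \notin X1 by apply: contra wX; apply: (subsetP X1X).
have wX2 : w \notin X2 by apply: contra wX; apply: (subsetP X2X).
case: (negative_parity Z') f1 f2 => /= f1 f2.
  exists X1, Z1, Y, Z'; rewrite addbT; split=> //.
  + by rewrite setSU.
  + by rewrite disjoint_sym; apply: disjointWr dYX.
  + by rewrite setSU.
  + exact: disjointWl Z1Z dZ.
  apply: (opened_odd euw eS wX1 wY dYP _ (disjointWl Z2Z dZ) f1 f2 op).
  by rewrite disjoint_sym; apply: disjointWr dYX.
exists X1, Z1, (w |: X2), Z2; rewrite addbF; split=> //.
+ by rewrite !subUset (subset_trans X1X) ?subsetUl // sub1set inE wY orbT /= subsetU // X2X.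
+ by rewrite disjoint_sym -setI_eq0 setIUl setU_eq0 !setI_eq0 disjoints1 wX1 disjoint_sym.
+ by rewrite subUset !subsetU ?Z1Z ?Z2Z.
exact: (opened_even euw eS wX1 wX2 f1 f2 op).
Qed.

(** The edges of [C] are paid for here: [m1] and [m2] are what the two families need beyond
    [k1 + #|eset C|] and [k2]. Either [m1] is at most half the length of [C] and [m2] is that
    length, or [m1] is 0 and [m2] is twice the length. *)
Lemma chain_close v u P S X Z e C : chain v u P S X Z -> joins e u v ->
    is_cycle C -> vset C = P -> eset C = e |: S -> e \notin S ->
    [disjoint Z & eset C] ->
  solved v X (Z :|: eset C).
Proof.
move=> [l PX sZ [k1 [k2 [le st]]]] euv cC CP CS eS dZ.
have /andP[vP uP] := link_ends l.
have vX : v \in X by apply: (subsetP PX).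
have SC : S \subset eset C by rewrite CS subsetUr.
set N := eset C in CS dZ SC *; have cN : #|N| = #|S| + 1 by rewrite CS cardsU1 eS addnC.
split=> //; first by apply: saturatedU => //; apply: saturated_cycle.
rewrite negative_parityU // (negative_parity_cycle cC).
rewrite cycle_edgesU (cycle_edges_cycle cC) cardsU disjoint_setI0 // cards0 subn0.
set K := cycle_edges Z in st *; set q := lollipop v X (Z :|: N).
suff [m1 [m2 [lem f1 f2]]] : exists m1 m2, [/\ m1.*2 + m2 <= #|N|.*2,
    family (nseq (negative_parity Z (+) negative_cycle s C) q) (k1 + m1 + #|N|) (K :|: N)
  & family (nseq (negative_parity Z (+) negative_cycle s C).*2 q) (k2 + m2) (K :|: N)].
  exists (k1 + m1 + #|N|), (k2 + m2); split=> //.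
  by clear -le lem; lia.
have posN : ~~ negative_cycle s C -> circuit_edges N.
  rewrite /negative_cycle cC => pC; exists C => //; left.
  by rewrite /positive_cycle cC.
have negN : negative_cycle s C -> q N.
  move=> nC; apply: lollipopS (lollipop_cycle nC _).
  - by rewrite CP.
  - exact: subsetUr.
  by rewrite CP.
have addN Q k : ~~ negative_cycle s C -> family Q k K -> family Q (k + #|N|) (K :|: N).
  by move=> /posN cN' fam; apply: family_circuit; apply: family_add.
have two : #|N| <= #|N|.*2 by rewrite -addnn leq_addr.
have eSK : e |: (S :|: K) = K :|: N by rewrite CS setUA setUC.
have lem2 m : m.*2 <= #|N| -> m.*2 + #|N| <= #|N|.*2.
  by rewrite -(addnn #|N|) leq_add2r.
have freeL X1 Z1 : X1 \subset X -> Z1 \subset Z ->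
    forall T, hooked P S v X1 Z1 T -> q T.
  move=> X1X Z1Z T /hooked_lollipop; apply: lollipopS => //.
  exact: subset_trans Z1Z (subsetUl _ _).
have freeR X2 Z2 : X2 \subset X -> Z2 \subset Z -> v \notin X2 ->
    forall T, hooked P S u X2 Z2 T -> exists T',
      [/\ q T', #|T'| <= #|T| + 1 & [set e] :|: T \subset T'].
  move=> X2X Z2Z vX2 T hT; exists (e |: T); split=> //.
    apply: lollipopS (hooked_lollipop (hooked_step euv vX2 hT)).
      by rewrite subUset sub1set vX.
    exact: subset_trans Z2Z (subsetUl _ _).
  by rewrite cardsU1 addnC leq_add2l leq_b1.
have free2 X1 Z1 X2 Z2 : X1 \subset X -> X2 \subset X -> Z1 \subset Z ->
    Z2 \subset Z -> v \notin X2 ->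
    family [:: hooked P S v X1 Z1; hooked P S u X2 Z2] (k2 + #|S|) (S :|: K) ->
  family [:: q; q] (k2 + #|N|) (K :|: N).
  move=> X1X X2X Z1Z Z2Z vX2.
  move=> /family_swap/(family_map (freeR _ _ X2X Z2Z vX2))/family_swap.
  rewrite eSK cN addnA; apply: family_implies => //.
  by split; first exact: freeL.
(* A positive cycle is a circuit by itself. The open strand of the one-strand solution must end at
   [v]; if it stands at [u] it crosses [e], hence [a + 1]. *)
have odd_pos X1 Z1 X2 Z2 : X1 \subset X -> X2 \subset X -> Z1 \subset Z ->
    Z2 \subset Z -> v \notin X2 -> ~~ negative_cycle s C ->
    opened P S v u X1 Z1 X2 Z2 true k1 k2 K ->
  exists m1 m2, [/\ m1.*2 + m2 <= #|N|.*2,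
    family [:: q] (k1 + m1 + #|N|) (K :|: N) & family [:: q; q] (k2 + m2) (K :|: N)].
  move=> X1X X2X Z1Z Z2Z vX2 pC [g2 [a [b [lab ga gb]]]].
  have ga' : family [:: q] (k1 + (a + 1)) K.
    have := family_map (freeR _ _ X2X Z2Z vX2) ga.
    by rewrite addnA; apply: familyS => //; apply: subsetUr.
  have gb' : family [:: q] (k1 + b) K.
    by apply: family_implies gb => //; split=> //; apply: freeL.
  have lab' : a + 1 + b <= #|N| by rewrite cN addnAC leq_add2r.
  have [m lem fm] := family_min lab' ga' gb'.
  exists m, #|N|; split; first exact: lem2.
    exact: addN.
  exact: free2 g2.
case: st => [[/negPf np g1 g2]|[np so]|].
- rewrite np addFb; have [nC|pC] := boolP (negative_cycle s C).
    (* A negative cycle with no odd subtree on the walk is itself the strand, taken twice in the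
       second family. *)
    exists 0, (#|N| + #|N|); rewrite addn0 addnA; split; first by rewrite add0n addnn.
      exact: family_add (negN nC) g1.
    apply: familyS (family_add (negN nC) (family_add (negN nC) g2)).
      by rewrite ?addnA.
    exact: subsetUl.
  by exists 0, #|N|; rewrite addn0; split=> //; apply: addN.
- have op := single_odd_opened so PX.
  rewrite np addTb; have [nC|pC] := boolP (negative_cycle s C); last first.
    by case: op => X1 [X2 [X1X X2X vX2 op]]; apply: odd_pos op.
  case: so => x [Y [P1 [S1 [P2 [S2 [_ [[_ _ _ eY] [YX f1 f2]]]]]]]].
  have xC : x \in vset C by rewrite CP -sub1set -eY subsetIr.
  have jn T : lollipop x Y Z T -> exists T',
      [/\ circuit_edges T', #|T'| <= #|T| + #|N| & N :|: T \subset T'].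
    move=> lT; exists (T :|: N); split; last by rewrite setUC.
      apply: lollipop_join dZ lT (lollipop_cycle nC xC).
      by rewrite CP eY.
    by rewrite leq_card_setU.
  (* The cycle is the end of one barbell in the first family and of two in the second, all through
     [x]. *)
  exists 0, (#|N| + #|N|); rewrite addn0 addnA; split; first by rewrite add0n addnn.
    have /family_circuit := family_map jn f1; by rewrite setUC.
  have /family_circuit/(family_map jn)/family_circuit g := family_map jn f2.
  by apply: familyS g; [rewrite ?addnA | rewrite setUA setUid setUC].
case=> X1 [Z1 [X2 [Z2 [sX dX sZ12 dZ12 op]]]].
move: sX; rewrite subUset => /andP[X1X X2X].
move: sZ12; rewrite subUset => /andP[Z1Z Z2Z].
have [g2 [a [b [lab ga gb]]]] := op.
have vX2 : v \notin X2.
  have [T [/hooked_lollipop/lollipop_root vX1 _ _]] := g2.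
  by have /pred0P/(_ v) := dX; rewrite /= vX1 /= => ->.
have dN Z0 : Z0 \subset Z -> [disjoint Z0 & N] by move=> Z0Z; apply: disjointWl dZ.
have wrap T1 T2 : hooked P S v X1 Z1 T1 -> hooked P S u X2 Z2 T2 -> exists T,
    [/\ circuit_edges T, #|T| <= #|T1| + #|T2| + 1 & [set e] :|: (T1 :|: T2) \subset T].
  move=> /hooked_lollipop h1 h2; exists (T1 :|: (e |: T2)); split.
  - apply: lollipop_join dZ12 h1 (hooked_lollipop (hooked_step euv vX2 h2)).
    by rewrite setIUr (disjoint_setI0 dX) setU0 subsetIr.
  - have [+ _] := leq_card_setU T1 (e |: T2); move/leq_trans; apply.
    by rewrite -addnA leq_add2l cardsU1 addnC leq_add2l leq_b1.
  by rewrite setUCA.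
(* With evenly many odd subtrees, the first alternative leaves nothing open and the second joins its
   two open strands over [e]. *)
have even_end : ~~ negative_parity Z ->
    exists2 m, m.*2 <= #|N| & family [::] (k1 + m) K.
  move=> /negPf np; rewrite np /= in ga gb.
  have gb' : family [::] (k1 + (b + 1)) K.
    have := family_circuit (family_join wrap gb).
    by rewrite addnA; apply: familyS => //; apply: subsetUr.
  by apply: family_min ga gb'; rewrite cN addnA leq_add2r.
(* Joined over [e], the two open strands complete a covering of [C] at the price of its length. *)
have wrap2 : family [::] (k2 + #|N|) (K :|: N).
  by have := family_circuit (family_join wrap g2); rewrite eSK cN addnA.
have [np|np] := boolP (negative_parity Z); have [nC|pC] := boolP (negative_cycle s C).
(* Oddly many odd subtrees on a negative cycle: in either alternative the one open strand forms a
   barbell with [C]. *)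
- have hook0 v' Z0 X0 : Z0 \subset Z -> forall T, hooked P S v' X0 Z0 T -> exists T',
      [/\ circuit_edges T', #|T'| <= #|T| + #|N| & N :|: T \subset T'].
    by move=> Z0Z T; apply: hooked_circuit => //; apply: dN.
  rewrite np /= in ga gb.
  have ga' := family_circuit (family_map (hook0 _ _ _ Z2Z) ga).
  have gb' := family_circuit (family_map (hook0 _ _ _ Z1Z) gb).
  rewrite addnAC in ga'; rewrite addnAC in gb'.
  have lab' : a + b <= #|N| by rewrite cN (leq_trans lab) ?leq_addr.
  have [m lem fm] := family_min lab' ga' gb'.
  exists m, #|N|; split; [exact: lem2 | by rewrite addnAC setUC | exact: wrap2].
- by rewrite np in op; apply: odd_pos op.
(* Here [C] is itself the strand of the first family, and the two open strands are those of the
   second. *)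
- have [m lem fm] := even_end np; exists m, #|N|; split; first exact: lem2.
    exact: family_add (negN nC) fm.
  exact: free2 g2.
have [m lem fm] := even_end np; exists m, #|N|; split; first exact: lem2.
  exact: addN.
exact: wrap2.
Qed.

(** * Contraction of a cycle with the parts attached to it *)

Lemma chain_path (r : vertex H -> vertex H) (l : edge H -> option (vertex H)) v p :
    is_path v p -> r v = v ->
    (forall x, x \in unzip2 p -> solved x [set z | r z == x] [set f | l f == Some x]) ->
  chain v (walk_end v p) [set z in walk_vertices v p] [set f in unzip1 p]
    (v |: [set z | r z \in unzip2 p]) [set f | l f \in [seq Some x | x <- unzip2 p]].
Proof.
move=> + rv; elim/last_ind: p => [|p [e w] IH] ip sol.
  by have := chain_root v; congr chain; apply/setP=> z; rewrite !inE ?orbF.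
have [walkp] := andP ip; rewrite -cats1 walk_cat /= andbT in walkp.
have /andP[wp euw] := walkp.
rewrite /walk_vertices /unzip2 map_rcons -rcons_cons rcons_uniq => /andP[wnp up].
have ipp : is_path v p by rewrite /is_path wp.
have wp' : w \notin unzip2 p by apply: contra wnp; rewrite inE orbC => ->.
have wv : w != v by apply: contraNneq wnp => ->; apply: mem_head.
have sub x : x \in unzip2 p -> x \in unzip2 (rcons p (e, w)).
  by rewrite /unzip2 map_rcons mem_rcons inE orbC => ->.
have c := IH ipp (fun x xp => sol x (sub x xp)).
have wl : w \in unzip2 (rcons p (e, w)) by rewrite /unzip2 map_rcons mem_rcons mem_head.
have dY : [disjoint [set z | r z == w] & v |: [set z | r z \in unzip2 p]].
  apply/pred0P=> z; rewrite /= !inE; apply/andP=> -[/eqP rz].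
  case/orP=> [/eqP zv|]; last by rewrite rz (negPf wp').
  by move: wv; rewrite -rz zv rv eqxx.
have dZ : [disjoint [set f | l f \in [seq Some x | x <- unzip2 p]] & [set f | l f == Some w]].
  apply/pred0P=> f; rewrite /= !inE; apply/andP=> -[/mapP[x xp ->] /eqP[xw]].
  by rewrite -xw xp in wp'.
have := chain_step c euw dY dZ (sol w wl); congr chain.
- by rewrite /walk_end /unzip2 map_rcons last_rcons.
- by apply/setP=> z; rewrite in_setU1 !in_set mem_rcons in_cons.
- by apply/setP=> z; rewrite in_setU1 !in_set /unzip1 map_rcons mem_rcons in_cons.
- apply/setP=> z; rewrite in_setU in_setU1 !in_set in_set1 mem_rcons in_cons -orbA.
  by congr (_ || _); rewrite orbC.
by apply/setP=> f; rewrite in_setU !in_set map_rcons mem_rcons in_cons orbC.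
Qed.

(** The cycle is walked once around from [v], whose own part is left out of the walk and merged at
    the end. *)
Lemma solved_cycle (r : vertex H -> vertex H) (l : edge H -> option (vertex H)) C v :
    is_cycle C -> v \in vset C ->
    (forall x, x \in vset C -> solved x [set z | r z == x] [set f | l f == Some x]) ->
    (forall f, f \in eset C -> l f = None) ->
  solved v [set z | r z \in vset C]
    (eset C :|: [set f | l f \in [set Some x | x in vset C]]).
Proof.
move=> cC vC sol lN; have [e [u [eC euv]]] := cycle_edge_at cC vC.
have [p [ip pu nep defC]] := cycle_traversal edc cC eC euv.
have rx x : x \in vset C -> r x = x by move=> /sol[]; rewrite inE => /eqP.
have CE x : x \in vset C = (x == v) || (x \in unzip2 p).
  by rewrite defC /= !inE.
have sol' x : x \in unzip2 p -> solved x [set z | r z == x] [set f | l f == Some x].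
  by move=> xp; apply: sol; rewrite CE xp orbT.
have vnp : v \notin unzip2 p by case/andP: ip => _ /andP[].
have := chain_path ip (rx v vC) sol'; rewrite pu => c.
have eN : e \notin [set f in unzip1 p] by rewrite inE.
have dZ : [disjoint [set f | l f \in [seq Some x | x <- unzip2 p]] & eset C].
  apply/pred0P=> f; rewrite /= inE; apply/andP=> -[/mapP[x _ lf] /lN].
  by rewrite lf.
have solC := chain_close c euv cC (congr1 fst defC) (congr1 snd defC) eN dZ.
have dY : [set z | r z == v] :&: (v |: [set z | r z \in unzip2 p]) \subset [set v].
  apply/subsetP=> z; rewrite in_setI in_setU1 !in_set in_set1.
  by case/andP=> /eqP -> /orP[//|vp]; rewrite vp in vnp.
have dZ' : [disjoint [set f | l f == Some v]
    & [set f | l f \in [seq Some x | x <- unzip2 p]] :|: eset C].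
  apply/pred0P=> f; rewrite /= in_setU !in_set; apply/andP=> -[/eqP lf /orP[]].
    by rewrite lf => /mapP[x xp [vx]]; rewrite vx xp in vnp.
  by move/lN; rewrite lf.
have := solved_merge dY dZ' (sol v vC) solC; congr solved.
  apply/setP=> z; rewrite in_setU in_setU1 !in_set CE orbCA.
  by have [->|//] := eqVneq z v; rewrite rx // eqxx.
apply/setP=> f; rewrite !in_setU !in_set orbA orbC; congr (_ || _).
apply/orP/imsetP=> [[/eqP ->|/mapP[x xp ->]]|[x]].
- by exists v.
- by exists x; rewrite ?CE ?xp ?orbT.
rewrite CE => /orP[/eqP->|xp] ->; first by left.
by right; apply: map_f.
Qed.

(** * Contraction of the whole graph *)

(* The solved parts to be contracted are given by labels: r z and l f are the
   roots of the parts containing z and f, and l f is None if there is none. *)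
Definition contractible x0 X E : Prop :=
  forall (r : vertex H -> vertex H) (l : edge H -> option (vertex H)),
    (forall x, x \in X -> solved x [set z | r z == x] [set f | l f == Some x]) ->
    (forall f, f \in E -> l f = None) ->
  solved x0 [set z | r z \in X] (E :|: [set f | l f \in [set Some x | x in X]]).

(** The piece [(W, F)] and the parts hanging at it become one part rooted at [v]. Relabelling them
    by [v] reduces the claim to the smaller graph [(X', E')]. *)
Lemma contractible_extend x0 X' E' (W : {set vertex H}) (F : {set edge H}) v
    (r : vertex H -> vertex H) (l : edge H -> option (vertex H)) :
  contractible x0 X' E' -> W :&: X' = [set v] -> [disjoint F & E'] ->
  (forall x, x \in X' :|: W -> solved x [set z | r z == x] [set f | l f == Some x]) ->
  (forall f, f \in E' :|: F -> l f = None) ->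
  solved v [set z | r z \in W] (F :|: [set f | l f \in [set Some x | x in W]]) ->
  solved x0 [set z | r z \in X' :|: W]
    ((E' :|: F) :|: [set f | l f \in [set Some x | x in X' :|: W]]).
Proof.
move=> IH WX dF sol lN solv.
have /andP[vW vX'] : (v \in W) && (v \in X') by rewrite -in_setI WX inE.
pose r' z := if r z \in W then v else r z.
pose l' f := if (f \in F) || (l f \in [set Some x | x in W]) then Some v else l f.
have xW x : x \in X' -> x != v -> x \notin W.
  move=> xX' xv; apply: contra xv => xW'.
  by rewrite -in_set1 -WX inE xW'.
have SomeW x (A : {set vertex H}) : (Some x \in [set Some y | y in A]) = (x \in A).
  by apply: mem_imset; apply: Some_inj.
have NoneW (A : {set vertex H}) : (None \in [set Some y | y in A]) = false.
  by apply/negP=> /imsetP[].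
have [||] := IH r' l'.
- move=> x xX'; have [->|xv] := eqVneq x v.
    move: solv; congr solved; apply/setP=> z; rewrite ?in_setU !in_set.
      rewrite /r'; case: ifP => [_|/negbT zW]; first by rewrite eqxx.
      by apply/esym/negbTE; apply: contraNneq zW => ->.
    rewrite /l'; case: ifP => [_|/negbT]; first by rewrite eqxx.
    rewrite negb_or => /andP[_ zW].
    by apply/esym/negbTE; apply: contraNneq zW => ->; rewrite SomeW.
  have nxW := xW x xX' xv.
  have := sol x; rewrite inE xX' => /(_ isT); congr solved; apply/setP=> z; rewrite !in_set.
    rewrite /r'; case: ifP => // zW; rewrite eq_sym [v == x]eq_sym (negPf xv).
    by apply/negbTE; apply: contraNneq nxW => ->.
  rewrite /l'; case: ifP => // /orP zW; rewrite [Some v == _]eq_sym.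
  have -> : (Some x == Some v) = false by apply/negP=> /eqP[] /eqP; rewrite (negPf xv).
  apply/negbTE; case: zW => zW; first by rewrite lN // inE zW orbT.
  by apply: contraNneq nxW => lz; rewrite lz SomeW in zW.
- move=> f fE'; rewrite /l' lN ?NoneW ?inE ?fE' // orbF.
  by case: ifP => // fF; have /pred0P/(_ f) := dF; rewrite /= fF fE'.
move=> vY sZ ks; suff : solved x0 [set z | r' z \in X']
  (E' :|: [set f | l' f \in [set Some x | x in X']]).
  congr solved; apply/setP=> z; rewrite ?in_setU !in_set ?in_setU.
    by rewrite /r'; case: ifP => zW; rewrite ?vX' ?orbT ?orbF.
  rewrite imsetU in_setU /l'; case: ifP => [/orP[] ->|/negbT].
  + by rewrite SomeW vX' !orbT.
  + by rewrite SomeW vX' !orbT.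
  by rewrite negb_or => /andP[/negPf-> /negPf->]; rewrite !orbF.
by [].
Qed.

(** The piece attached last is contracted first. For a bridge, the part at [w] is moved over [e] and
    merged with the one at [v]; a cycle is handled by [solved_cycle]. *)
Lemma grow_contractible x0 X E : grow x0 X E -> contractible x0 X E.
Proof.
elim=> [|{}X {}E v w e g IH vX wX evw eE ne|{}X {}E v C g IH cC CX dC] r l sol lN.
- have := sol x0 (set11 x0); congr solved; apply/setP=> z.
    by rewrite !in_set in_set1.
  by rewrite in_setU in_set0 !in_set imset_set1 in_set1.
- have eX : w |: X = X :|: [set v; w].
    by rewrite setUA (setUidPl (_ : [set v] \subset X)) ?sub1set // setUC.
  rewrite eX in sol *; rewrite [e |: E]setUC in lN *.
  apply: (contractible_extend IH _ _ sol lN).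
  - apply/setP=> x; rewrite !inE; apply/andP/eqP=> [[/orP[]/eqP-> //]|->].
      by rewrite (negPf wX).
    by rewrite eqxx.
  - by rewrite disjoints1.
  have vw : v != w by apply: contraNneq wX => <-.
  have solv := sol v; have solw := sol w; rewrite !inE vX in solv.
  have {}solv := solv isT; have {}solw := solw _; rewrite !inE eqxx !orbT in solw.
  have {}solw := solw isT.
  have rv : r v = v by case: solv => + _ _; rewrite inE => /eqP.
  have le : l e = None by apply: lN; rewrite !inE eqxx orbT.
  have vY : v \notin [set z | r z == w] by rewrite inE rv.
  have eZ : e \notin [set f | l f == Some w] by rewrite inE le.
  have dY : [set z | r z == v] :&: (v |: [set z | r z == w]) \subset [set v].
    apply/subsetP=> z; rewrite !inE => /andP[/eqP -> /orP[//|vw']].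
    by rewrite (negPf vw) in vw'.
  have dZ : [disjoint [set f | l f == Some v] & e |: [set f | l f == Some w]].
    apply/pred0P=> f; rewrite /= !inE; apply/andP=> -[/eqP lf /orP[/eqP fe|]].
      by rewrite fe le in lf.
    by rewrite lf => /eqP[vw']; rewrite vw' eqxx in vw.
  have := solved_merge dY dZ solv (solved_bridge evw vY eZ ne solw).
  congr solved; apply/setP=> z.
    rewrite !inE orbCA; have [->|//] := eqVneq z v; by rewrite rv eqxx.
  rewrite !inE imsetU !imset_set1 !inE.
  by rewrite orbCA.
apply: (contractible_extend IH CX dC sol lN).
have /andP[vC _] : (v \in vset C) && (v \in X) by rewrite -in_setI CX inE.
apply: solved_cycle => // [x xC|f fC]; first by apply: sol; rewrite inE xC orbT.
by apply: lN; rewrite inE fC orbT.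
Qed.

(** * From edge sets back to circuits, and the final bound *)

Lemma circuits_of_edges F : (forall T, T \in F -> circuit_edges T) ->
  exists2 G : seq (subgraph H), forall C, C \in G -> circuit s C & map (@eset H) G = F.
Proof.
elim: F => [|T F IH] cF; first by exists [::].
have [B cB BT] := cF T (mem_head _ _).
have [|G cG GF] := IH; first by move=> T' T'F; apply: cF; rewrite inE T'F orbT.
exists (B :: G); last by rewrite /= BT GF.
by move=> C; rewrite inE => /orP[/eqP->|/cG].
Qed.

Lemma short_circuit_cover : connected (whole H) ->
    ~~ odd #|[set C : subgraph H | negative_cycle s C]| ->
  exists F : seq (subgraph H), [/\ forall C, C \in F -> circuit s C,
    covers_cycles F & 3 * family_length F <= 4 * #|edge H|].
Proof.
move=> /grow_full[//|x0 g] even_neg.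
(* Initially every vertex is a part of its own and no edge belongs to a part. *)
have [||_ _ [k1 [k2]]] := @grow_contractible _ _ _ g id (fun=> None).
- move=> x _; have := solved_vertex x; congr solved; apply/setP=> z; rewrite !inE //.
- by [].
(* The whole graph has even parity, so no strand is left over at the root. *)
rewrite setTU; have -> : negative_parity setT = false.
  apply: negbTE; move: even_neg; rewrite /negative_parity; congr (~~ odd #|pred_of_set _|).
  by apply/setP=> C; rewrite !inE subsetT andbT.
rewrite /= cardsT => -[f1 f2 le].
have [k lek [F [cF leF coverF]]] : exists2 k, 3 * k <= 4 * #|edge H|
    & family [::] k (cycle_edges setT).
  (* Three times the smaller of [k1] and [k2] is at most [2 * k1 + k2]. *)
  by have [k12|k21] := leqP k1 k2; [exists k1 | exists k2] => //; lia.
have [G cG GF] := circuits_of_edges cF; exists G; split=> //.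
- move=> C e cC eC.
  have : e \in \bigcup_(T <- F) T.
    apply: (subsetP coverF); rewrite !inE; apply/existsP; exists C.
    by rewrite cC.
  rewrite -GF big_map; elim: (G) => [|D G' IH]; first by rewrite big_nil inE.
  rewrite big_cons inE => /orP[eD|/IH[D' D'G eD']].
    by exists D => //; apply: mem_head.
  by exists D' => //; rewrite inE D'G orbT.
apply: leq_trans lek; rewrite leq_pmul2l //.
by move: leF; rewrite -GF big_map.
Qed.

End Families.

Theorem theorem2p5 (H : multigraph) (sigma : edge H -> bool)
  (ct : signed_cycle_tree sigma)
  (even_neg : ~~ odd #|[set C : subgraph H | negative_cycle sigma C]|) :
  exists F : seq (subgraph H),
    [/\ forall C : subgraph H, C \in F -> circuit sigma C,
        covers_cycles F
      & ((family_length F)%:R <= 4%:R / 3%:R * #|edge H|%:R :> rat)%R].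
Proof.
case: ct => -[conn _ edc] _.
have [F [cF covF leF]] := short_circuit_cover edc conn even_neg.
exists F; split=> //.
rewrite mulrAC ler_pdivlMr ?ltr0n // mulrC -!natrM ler_nat.
exact: leF.
Qed.
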